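(* Let $\mathcal L$ be a left bialgebroid over $B$. (1) For any $U\in C^1(\mathcal L,B)$, the formula $$\partial U(X,Y)=U^{-1}\big(X_{(1)}t(U^{-1}(Y_{(1)}))\big)\,U(X_{(2)}Y_{(2)}),\qquad X,Y\in\mathcal L,$$ where $U^{-1}$ is the inverse of $U$ under the convolution product, defines a 2-cocycle $\partial U\in Z^2(\mathcal L,B)$. Moreover, the subset $Z^1(\mathcal L,B)$ of those $U\in C^1(\mathcal L,B)$ for which $\partial U$ is trivial (i.e. $\partial U(X,Y)=\varepsilon(XY)$ for all $X,Y\in\mathcal L$) forms a submonoid under convolution, coinciding with $\mathcal B_{ver}(\mathcal L)^{op}$. (2) If $\Gamma\in Z^2(\mathcal L,B)$ and $U\in C^1(\mathcal L,B)$ then $$\Gamma^U(X,Y)=U^{-1}\big(X_{(1)}t(U^{-1}(Y_{(1)}))\big)\,\Gamma(X_{(2)},Y_{(2)})\,U(X_{(3)}Y_{(3)}),\qquad X,Y\in\mathcal L,$$ is another 2-cocycle in $Z^2(\mathcal L,B)$, and this defines an action of the group $C^1(\mathcal L,B)$ on the set $Z^2(\mathcal L,B)$. The set of orbits in $Z^2(\mathcal L,B)$ under this action is denoted $\mathcal H^2(\mathcal L,B)$.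
   Context: All algebras are unital associative over a field $k$ and algebra maps are unital. Let $B$ be an algebra, $B^e=B\otimes B^{op}$. A left $B$-bialgebroid is an algebra $\mathcal L$ with algebra maps $s:B\to\mathcal L$ (source) and $t:B^{op}\to\mathcal L$ (target) such that $s(b)t(b')=t(b')s(b)$, made a $B$-bimodule by $b.X.c=s(b)t(c)X$, together with $B$-bimodule maps $\Delta:\mathcal L\to\mathcal L\otimes_B\mathcal L$, $\Delta(X)=X_{(1)}\otimes_B X_{(2)}$, and $\varepsilon:\mathcal L\to B$ forming a $B$-coring (coassociative and counital), such that (i) $\Delta$ takes values in, and is an algebra map to, the Takeuchi product $\mathcal L\times_B\mathcal L=\{\sum_i X_i\otimes_B Y_i:\ \sum_i X_it(b)\otimes_B Y_i=\sum_i X_i\otimes_B Y_is(b)\ \forall b\in B\}$ (an algebra under factorwise multiplication); (ii) $\varepsilon(1)=1$ and $\varepsilon(Xs(\varepsilon(Y)))=\varepsilon(XY)=\varepsilon(Xt(\varepsilon(Y)))$ for all $X,Y\in\mathcal L$. Here $\mathcal L\otimes_B\mathcal L$ is the quotient of $\mathcal L\otimes\mathcal L$ by the relations $t(b)X\otimes Y=X\otimes s(b)Y$. $C^1(\mathcal L,B)$ is the group, under convolution $(f\star g)(X)=f(X_{(1)})g(X_{(2)})$ with unit $\varepsilon$, of convolution-invertible $B$-bimodule maps $U:\mathcal L\to B$ such that $U(1)=1$ and $U(Xs(b))=U(Xt(b))$ for all $X\in\mathcal L$, $b\in B$. $\mathcal L\otimes_{B^e}\mathcal L$ is the quotient of $\mathcal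 L\otimes\mathcal L$ by $Xs(a)t(b)\otimes Y=X\otimes s(a)t(b)Y$, with $B$-bimodule structure $b.(X,Y).c=(s(b)t(c)X,Y)$. The space ${}_B\mathrm{Hom}_B(\mathcal L\otimes_{B^e}\mathcal L,B)$ of $B$-bimodule maps is an algebra with convolution product $(f\star g)(X,Y)=f(X_{(1)},Y_{(1)})g(X_{(2)},Y_{(2)})$ and unit $(X,Y)\mapsto\varepsilon(XY)$ (the trivial 2-cocycle). $Z^2(\mathcal L,B)$ (invertible normalised 2-cocycles) is the set of convolution-invertible elements $\Gamma$ of this algebra such that for all $X,Y,Z\in\mathcal L$, $b\in B$: $\Gamma(X,s(\Gamma(Y_{(1)},Z_{(1)}))Y_{(2)}Z_{(2)})=\Gamma(s(\Gamma(X_{(1)},Y_{(1)}))X_{(2)}Y_{(2)},Z)$, $\Gamma(1,X)=\varepsilon(X)=\Gamma(X,1)$, and $\Gamma(X,Ys(b))=\Gamma(X,Yt(b))$. A vertical left bisection is a unital linear map $\sigma:\mathcal L\to B$ with $\sigma(t(b)X)=\sigma(X)b$, $\sigma\circ s=\mathrm{id}_B$ and $\sigma(XY)=\sigma(Xt(\sigma(Y)))=\sigma(Xs(\sigma(Y)))$ for all $b\in B$, $X,Y\in\mathcal L$. The set $\mathcal B_{ver}(\mathcal L)$ of these is a monoid with product $(\sigma\ast\tau)(X)=\sigma(s(\tau(X_{(1)}))X_{(2)})=\tau(X_{(1)})\sigma(X_{(2)})$ and identity $\varepsilon$; $\mathcal B_{ver}(\mathcal L)^{op}$ denotes the same set with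 the opposite product.
   Formalization: Z^1(L,B) is identified with the convolution-invertible vertical bisections (with the opposite product), not with all of B_ver(L), since a vertical bisection need not be convolution-invertible and so need not lie in C^1(L,B). *)

(* Defs.v *)
From HB Require Import structures.
From mathcomp Require Import all_boot all_order all_algebra.
From mathcomp Require Import boolp classical_sets.

Set Implicit Arguments.
Unset Strict Implicit.
Unset Printing Implicit Defensive.

Import GRing.Theory.

Local Open Scope ring_scope.
Local Open Scope quotient_scope.

(* [tens r l] is the quotient of the tensor product of M and N over k by the
   subspace spanned by the elements r i m (x) n - m (x) l i n.  Its elements
   are classes of formal sums of pure tensors; the scalar a in [tens_bal] is
   there because r i and l i are arbitrary functions, not assumed linear. *)
Section TensorDef.
Variables (k : fieldType) (M N : lmodType k) (I : Type).
Variables (r : I -> M -> M) (l : I -> N -> N).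

Inductive tens_rel : seq (M * N) -> seq (M * N) -> Prop :=
| tens_refl s : tens_rel s s
| tens_sym s t : tens_rel s t -> tens_rel t s
| tens_trans s t u : tens_rel s t -> tens_rel t u -> tens_rel s u
| tens_cat s s' t t' :
    tens_rel s s' -> tens_rel t t' -> tens_rel (s ++ t) (s' ++ t')
| tens_comm s t : tens_rel (s ++ t) (t ++ s)
| tens_zero n : tens_rel [:: (0, n)] [::]
| tens_addl m m' n : tens_rel [:: (m + m', n)] [:: (m, n); (m', n)]
| tens_addr m n n' : tens_rel [:: (m, n + n')] [:: (m, n); (m, n')]
| tens_scale a m n : tens_rel [:: (a *: m, n)] [:: (m, a *: n)]
| tens_bal a i m n : tens_rel [:: (a *: r i m, n)] [:: (a *: m, l i n)].

Definition tens_relb : rel (seq (M * N)) := fun s t => `[< tens_rel s t >].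

Lemma tens_relb_refl : reflexive tens_relb.
Proof. by move=> s; apply/asboolP/tens_refl. Qed.

Lemma tens_relb_sym : symmetric tens_relb.
Proof. by move=> s t; apply/asboolP/asboolP; exact: tens_sym. Qed.

Lemma tens_relb_trans : transitive tens_relb.
Proof.
by move=> t s u /asboolP st /asboolP tu; apply/asboolP/(tens_trans st tu).
Qed.

Canonical tens_equiv :=
  EquivRel tens_relb tens_relb_refl tens_relb_sym tens_relb_trans.

Definition tens : Type := {eq_quot tens_equiv}.
HB.instance Definition _ := Choice.on tens.

Definition tens_pi (s : seq (M * N)) : tens := \pi_{eq_quot tens_equiv} s.
Definition tens_repr (u : tens) : seq (M * N) :=
  repr (u : {eq_quot tens_equiv}).
Definition tmk (m : M) (n : N) : tens := tens_pi [:: (m, n)].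

Lemma tens_reprK : cancel tens_repr tens_pi.
Proof. by move=> u; exact: reprK. Qed.

Lemma tens_piP s t : tens_rel s t <-> tens_pi s = tens_pi t.
Proof.
split=> [st|]; first by apply/eqmodP/asboolP.
by move=> /eqmodP/asboolP.
Qed.

Definition tens_add (u v : tens) := tens_pi (tens_repr u ++ tens_repr v).
Definition tens_scl (a : k) (s : seq (M * N)) :=
  [seq (a *: p.1, p.2) | p <- s].
Definition tens_scalel (a : k) (u : tens) := tens_pi (tens_scl a (tens_repr u)).

Lemma tens_scl_rel a s t :
  tens_rel s t -> tens_rel (tens_scl a s) (tens_scl a t).
Proof.
elim=> {s t} /=.
- by move=> s; exact: tens_refl.
- by move=> s t _; exact: tens_sym.
- by move=> s t u _ st _; exact: tens_trans.
- by move=> s s' t t' _ ss' _ tt'; rewrite /tens_scl !map_cat; exact: tens_cat.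
- by move=> s t; rewrite /tens_scl !map_cat; exact: tens_comm.
- by move=> n; rewrite scaler0; exact: tens_zero.
- by move=> m m' n; rewrite scalerDr; exact: tens_addl.
- by move=> m n n'; exact: tens_addr.
- by move=> b m n; rewrite scalerA mulrC -scalerA; exact: tens_scale.
- by move=> b i m n; rewrite !scalerA; exact: tens_bal.
Qed.

Lemma tens_piD s t : tens_add (tens_pi s) (tens_pi t) = tens_pi (s ++ t).
Proof. by apply/tens_piP/tens_cat; apply/tens_piP; rewrite tens_reprK. Qed.

Lemma tens_piZ a s : tens_scalel a (tens_pi s) = tens_pi (tens_scl a s).
Proof. by apply/tens_piP/tens_scl_rel/tens_piP; rewrite tens_reprK. Qed.

Lemma tens_ind_pi (P : tens -> Prop) : (forall s, P (tens_pi s)) -> forall u, P u.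
Proof. by move=> Ps u; rewrite -[u]tens_reprK. Qed.

Lemma tens_addA : associative tens_add.
Proof.
elim/tens_ind_pi=> s; elim/tens_ind_pi=> t; elim/tens_ind_pi=> u.
by rewrite !tens_piD catA.
Qed.

Lemma tens_addC : commutative tens_add.
Proof.
elim/tens_ind_pi=> s; elim/tens_ind_pi=> t.
by rewrite !tens_piD; apply/tens_piP/tens_comm.
Qed.

Lemma tens_add0 : left_id (tens_pi [::]) tens_add.
Proof. by elim/tens_ind_pi=> s; rewrite tens_piD. Qed.

Lemma tens_addN : left_inverse (tens_pi [::]) (tens_scalel (- 1)) tens_add.
Proof.
elim/tens_ind_pi=> s; rewrite tens_piZ tens_piD.
have addCA u v w : tens_add u (tens_add v w) = tens_add v (tens_add u w).
  by rewrite !tens_addA (tens_addC u).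
elim: s => [//|[m n] s IH].
transitivity (tens_add (tens_pi [:: (- 1 *: m, n)])
  (tens_add (tens_pi (tens_scl (- 1) s))
    (tens_add (tens_pi [:: (m, n)]) (tens_pi s)))); first by rewrite !tens_piD.
rewrite (addCA (tens_pi (tens_scl _ _))) [tens_add (tens_pi (tens_scl _ _)) _]tens_piD.
rewrite IH (tens_addC _ (tens_pi [::])) tens_add0 tens_piD; apply/tens_piP.
apply: (tens_trans (t := [:: (- m + m, n)])).
  by rewrite scaleN1r; exact/tens_sym/tens_addl.
by rewrite addNr; exact: tens_zero.
Qed.

HB.instance Definition _ :=
  GRing.isZmodule.Build tens tens_addA tens_addC tens_add0 tens_addN.

Lemma tens_scaleA a b u :
  tens_scalel a (tens_scalel b u) = tens_scalel (a * b) u.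
Proof.
elim/tens_ind_pi: u => s; rewrite !tens_piZ /tens_scl -map_comp.
by congr tens_pi; apply: eq_map => p /=; rewrite scalerA.
Qed.

Lemma tens_scale1 : left_id 1 tens_scalel.
Proof.
elim/tens_ind_pi=> s; rewrite tens_piZ; congr tens_pi.
by rewrite -[RHS]map_id; apply: eq_map => -[m n] /=; rewrite scale1r.
Qed.

Lemma tens_scaleDr : right_distributive tens_scalel +%R.
Proof.
move=> a; elim/tens_ind_pi=> s; elim/tens_ind_pi=> t.
by rewrite [_ + _]tens_piD !tens_piZ [RHS]tens_piD /tens_scl map_cat.
Qed.

Lemma tens_scaleDl v : {morph tens_scalel^~ v : a b / a + b}.
Proof.
move=> a b; elim/tens_ind_pi: v => s; rewrite !tens_piZ.
elim: s => [|[m n] s IH]; first by rewrite [RHS]tens_piD.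
rewrite /= -cat1s -[tens_pi _]tens_piD IH scalerDl.
rewrite -[(a *: m, n) :: _]cat1s -[(b *: m, n) :: _]cat1s.
rewrite -![tens_pi (_ ++ tens_scl _ _)]tens_piD.
rewrite (_ : tens_pi _ = tens_pi ([:: (a *: m, n)] ++ [:: (b *: m, n)])).
  by rewrite -tens_piD; exact: addrACA.
exact/tens_piP/tens_addl.
Qed.

HB.instance Definition _ := GRing.Zmodule_isLmodule.Build k tens
  tens_scaleA tens_scale1 tens_scaleDr tens_scaleDl.

Definition tsum (V : zmodType) (f : M -> N -> V) (u : tens) : V :=
  \sum_(p <- tens_repr u) f p.1 p.2.

Record balanced (V : zmodType) (f : M -> N -> V) : Prop := Balanced {
  balDl m m' n : f (m + m') n = f m n + f m' n;
  balDr m n n' : f m (n + n') = f m n + f m n';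
  balZ a m n : f (a *: m) n = f m (a *: n);
  balB a i m n : f (a *: r i m) n = f (a *: m) (l i n) }.

End TensorDef.

(* [\tsum_(m, n <- u) E] is Sweedler notation: the sum of the values of E over
   any representation of u as a sum of pure tensors m (x) n.  It does not
   depend on the representation as soon as E is balanced in (m, n). *)
Notation "\tsum_ ( m , n <- u ) E" := (tsum (fun m n => E) u)
  (at level 41, m name, n name, u at level 90, E at level 41,
   format "\tsum_ ( m ,  n  <-  u )  E") : ring_scope.

Section TensorTheory.
Variables (k : fieldType) (M N : lmodType k) (I : Type).
Variables (r : I -> M -> M) (l : I -> N -> N).
Local Notation T := (tens r l).
Local Notation "m (x) n" := (tmk r l m n) (at level 40).

Lemma tmk_balanced : balanced r l (fun m n => m (x) n : T).
Proof.
split=> *; rewrite ?[RHS]tens_piD; apply/tens_piP.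
- exact: tens_addl.
- exact: tens_addr.
- exact: tens_scale.
- exact: tens_bal.
Qed.

Lemma tmkZ a m n : a *: (m (x) n) = (a *: m) (x) n :> T.
Proof. exact: tens_piZ. Qed.

Lemma tens_pi_sum s : tens_pi r l s = \sum_(p <- s) p.1 (x) p.2.
Proof.
elim: s => [|[m n] s IH]; first by rewrite big_nil.
by rewrite big_cons -IH [RHS]tens_piD.
Qed.

Lemma tens_sumE (u : T) : u = \sum_(p <- tens_repr u) p.1 (x) p.2.
Proof. by rewrite -tens_pi_sum tens_reprK. Qed.

Section Fold.
Variables (V : zmodType) (f : M -> N -> V) (fB : balanced r l f).

Lemma bal0l n : f 0 n = 0.
Proof. by apply: (@addrI _ (f 0 n)); rewrite -(balDl fB) !addr0. Qed.

Lemma tens_rel_sum s t : tens_rel r l s t ->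
  \sum_(p <- s) f p.1 p.2 = \sum_(p <- t) f p.1 p.2.
Proof.
elim=> {s t} //=.
- by move=> s t u _ -> _ ->.
- by move=> s s' t t' _ e _ e'; rewrite !big_cat e e'.
- by move=> s t; rewrite !big_cat /= addrC.
- by move=> n; rewrite big_nil big_seq1 bal0l.
- by move=> m m' n; rewrite !big_cons big_nil /= addr0 (balDl fB) addr0.
- by move=> m n n'; rewrite !big_cons big_nil /= addr0 (balDr fB) addr0.
- by move=> a m n; rewrite !big_seq1 (balZ fB).
- by move=> a i m n; rewrite !big_seq1 (balB fB).
Qed.

Lemma tsum_pi s : tsum f (tens_pi r l s) = \sum_(p <- s) f p.1 p.2.
Proof. by apply/tens_rel_sum/tens_piP; rewrite tens_reprK. Qed.

Lemma tsum_tmk m n : tsum f (m (x) n) = f m n.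
Proof. by rewrite tsum_pi big_seq1. Qed.

Lemma tsumD : {morph (@tsum _ _ _ _ r l V f) : u v / u + v}.
Proof.
elim/tens_ind_pi=> s; elim/tens_ind_pi=> t.
by rewrite [_ + _]tens_piD !tsum_pi big_cat.
Qed.

Lemma tsum0 : tsum f (0 : T) = 0.
Proof. by rewrite tsum_pi big_nil. Qed.

Lemma tsum_sum J (s : seq J) (F : J -> T) :
  tsum f (\sum_(j <- s) F j) = \sum_(j <- s) tsum f (F j).
Proof. exact: (big_morph _ tsumD tsum0). Qed.

End Fold.

Lemma eq_tsum (V : zmodType) (f g : M -> N -> V) (u : T) :
  (forall m n, f m n = g m n) -> tsum f u = tsum g u.
Proof. by move=> fg; apply: eq_bigr. Qed.

Lemma tsum_lin (V W : zmodType) (h : V -> W) (f : M -> N -> V) (u : T) :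
  {morph h : x y / x + y} -> h (tsum f u) = \tsum_(m, n <- u) h (f m n).
Proof.
move=> hD; apply: (big_morph h hD).
by apply: (@addrI _ (h 0)); rewrite -hD !addr0.
Qed.

Lemma tsum_addf (V : zmodType) (f g : M -> N -> V) (u : T) :
  \tsum_(m, n <- u) (f m n + g m n) = tsum f u + tsum g u.
Proof. exact: big_split. Qed.

Lemma tsum_id (u : T) : \tsum_(m, n <- u) (m (x) n) = u.
Proof. exact/esym/tens_sumE. Qed.

Lemma tens_ext (V : zmodType) (f g : T -> V) :
  {morph f : x y / x + y} -> {morph g : x y / x + y} ->
  (forall m n, f (m (x) n) = g (m (x) n)) -> forall u, f u = g u.
Proof.
move=> fD gD fg u; rewrite -[u]tsum_id !(tsum_lin _ _ fD) !(tsum_lin _ _ gD).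
exact: eq_tsum.
Qed.

Definition tmap (f : M -> M) (g : N -> N) (u : T) : T :=
  \tsum_(m, n <- u) (f m (x) g n).

Record tmap_ok (f : M -> M) (g : N -> N) : Prop := TmapOk {
  tokl : linear f;
  tokr : linear g;
  tokrl i m : f (r i m) = r i (f m);
  toklr i n : g (l i n) = l i (g n) }.

Section Map.
Variables (f : M -> M) (g : N -> N) (fg : tmap_ok f g).

Lemma tmap_balanced : balanced r l (fun m n => f m (x) g n).
Proof.
case: fg => fl gl frl glr.
have fD m m' : f (m + m') = f m + f m' by rewrite -[m]scale1r fl !scale1r.
have gD m m' : g (m + m') = g m + g m' by rewrite -[m]scale1r gl !scale1r.
have f0 : f 0 = 0 by apply: (@addrI _ (f 0)); rewrite -fD !addr0.
have g0 : g 0 = 0 by apply: (@addrI _ (g 0)); rewrite -gD !addr0.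
have fZ a m : f (a *: m) = a *: f m by rewrite -[a *: m]addr0 fl f0 addr0.
have gZ a n : g (a *: n) = a *: g n by rewrite -[a *: n]addr0 gl g0 addr0.
split=> *; rewrite ?fD ?gD ?fZ ?gZ ?frl ?glr.
- exact: balDl tmk_balanced _ _ _.
- exact: balDr tmk_balanced _ _ _.
- exact: balZ tmk_balanced _ _ _.
- exact: balB tmk_balanced _ _ _ _.
Qed.

Lemma tmap_tmk m n : tmap f g (m (x) n) = f m (x) g n.
Proof. exact: tsum_tmk tmap_balanced _ _. Qed.

Lemma tmapD : {morph tmap f g : u v / u + v}.
Proof. exact: tsumD tmap_balanced. Qed.

End Map.

Lemma tsum_tmap (V : zmodType) (h : M -> N -> V) f g u :
  balanced r l h -> tsum h (tmap f g u) = \tsum_(m, n <- u) h (f m) (g n).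
Proof.
move=> hB; rewrite [tmap f g u]/tmap /tsum -/(tsum _ _) tsum_sum //.
by apply: eq_bigr => p _; rewrite tsum_tmk.
Qed.

End TensorTheory.

Section Bialgebroid.
Variables (k : fieldType) (B L : algType k).

(* An algebra map from the opposite of B is a unital linear map that reverses
   products. *)
Record source_target := SourceTarget {
  src : {lrmorphism B -> L};
  tgt : {linear B -> L};
  tgt1 : tgt 1 = 1;
  tgtM : forall b c, tgt (b * c) = tgt c * tgt b;
  src_tgtC : forall b c, src b * tgt c = tgt c * src b }.

Section Tensors.
Variable S : source_target.
Local Notation s := (src S).
Local Notation t := (tgt S).

(* L (x)_B L *)
Definition tensB : Type :=
  tens (fun b (X : L) => t b * X) (fun b (Y : L) => s b * Y).
HB.instance Definition _ := GRing.Lmodule.on tensB.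
Definition tmB (X Y : L) : tensB := tmk _ _ X Y.
Definition tmapB (f g : L -> L) (u : tensB) : tensB := tmap f g u.

(* L (x)_B (L (x)_B L) *)
Definition tensB3 : Type :=
  tens (fun b (X : L) => t b * X)
       (fun b (w : tensB) => tmapB (fun Y => s b * Y) id w).
HB.instance Definition _ := GRing.Lmodule.on tensB3.
Definition tmB3 (X : L) (w : tensB) : tensB3 := tmk _ _ X w.

(* L (x)_{B^e} L *)
Definition tensBe : Type :=
  tens (fun (ab : B * B) (X : L) => X * s ab.1 * t ab.2)
       (fun (ab : B * B) (Y : L) => s ab.1 * t ab.2 * Y).
HB.instance Definition _ := GRing.Lmodule.on tensBe.
Definition tmBe (X Y : L) : tensBe := tmk _ _ X Y.
Definition actBe (b c : B) (u : tensBe) : tensBe :=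
  tmap (fun X => s b * t c * X) id u.

Definition takeuchi (u : tensB) : Prop :=
  forall b, tmapB (fun X => X * t b) id u = tmapB id (fun Y => Y * s b) u.

(* Well defined when u is in the Takeuchi product; see [mulT_tmB]. *)
Definition mulT (u v : tensB) : tensB :=
  \tsum_(X', Y' <- v) \tsum_(X, Y <- u) tmB (X * X') (Y * Y').

End Tensors.

Record left_bialgebroid := LeftBialgebroid {
  st :> source_target;
  comul : {linear L -> tensB st};
  counit : {linear L -> B};
  comul_bimod : forall b c X,
    comul (src st b * tgt st c * X) =
    tmapB (fun Y => src st b * Y) (fun Y => tgt st c * Y) (comul X);
  counit_bimod : forall b c X,
    counit (src st b * tgt st c * X) = b * counit X * c;
  (* The left side is (comul (x) id) (comul X), reassociated. *)
  comulA : forall X,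
    \tsum_(X1, X2 <- comul X) \tsum_(X11, X12 <- comul X1)
       tmB3 X11 (tmB st X12 X2) =
    \tsum_(X1, X2 <- comul X) tmB3 X1 (comul X2);
  counitl : forall X, \tsum_(X1, X2 <- comul X) src st (counit X1) * X2 = X;
  counitr : forall X, \tsum_(X1, X2 <- comul X) tgt st (counit X2) * X1 = X;
  comul_takeuchi : forall X, takeuchi (comul X);
  comul1 : comul 1 = tmB st 1 1;
  comulM : forall X Y, comul (X * Y) = mulT (comul X) (comul Y);
  counit1 : counit 1 = 1;
  counitMs : forall X Y, counit (X * src st (counit Y)) = counit (X * Y);
  counitMt : forall X Y, counit (X * tgt st (counit Y)) = counit (X * Y) }.

End Bialgebroid.

Section Cochains.
Variables (k : fieldType) (B L : algType k) (H : left_bialgebroid B L).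
Local Notation s := (src H).
Local Notation t := (tgt H).
Local Notation D := (comul H).
Local Notation eps := (counit H).
Local Notation "X (x) Y" := (tmB H X Y) (at level 40).

Definition bimod_map (f : L -> B) : Prop :=
  linear f /\ forall b c X, f (s b * t c * X) = b * f X * c.

Definition conv (f g : L -> B) (X : L) : B :=
  \tsum_(X1, X2 <- D X) f X1 * g X2.

Definition conv_inverse (f g : L -> B) : Prop :=
  conv f g =1 eps /\ conv g f =1 eps.

Definition conv_invertible (f : L -> B) : Prop :=
  exists2 g, bimod_map g & conv_inverse f g.

Record C1 := MkC1 {
  C1_fun :> L -> B;
  C1_bimod : bimod_map C1_fun;
  C1_invertible : conv_invertible C1_fun;
  C1_1 : C1_fun 1 = 1;
  C1_st : forall X b, C1_fun (X * s b) = C1_fun (X * t b) }.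

Lemma C1_eq (U V : C1) : U =1 V -> U = V.
Proof.
case: U V => [f f1 f2 f3 f4] [g g1 g2 g3 g4] /funext /= e.
by case: _ / e in g1 g2 g3 g4 *; congr MkC1; exact: Prop_irrelevance.
Qed.

Section BimodMap.
Variables (f : L -> B) (fB : bimod_map f).

Lemma bmapD X Y : f (X + Y) = f X + f Y.
Proof. by rewrite -[X]scale1r fB.1 !scale1r. Qed.

Lemma bmap0 : f 0 = 0.
Proof. by apply: (@addrI _ (f 0)); rewrite -bmapD !addr0. Qed.

Lemma bmapZ a X : f (a *: X) = a *: f X.
Proof. by rewrite -[a *: X]addr0 fB.1 bmap0 addr0. Qed.

Lemma bmaps b X : f (s b * X) = b * f X.
Proof. by rewrite -[s b]mulr1 -(tgt1 H) fB.2 mulr1. Qed.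

Lemma bmapt c X : f (t c * X) = f X * c.
Proof. by rewrite -[t c]mul1r -(rmorph1 s) fB.2 mul1r. Qed.

End BimodMap.

Lemma eps_bimod : bimod_map eps.
Proof. by split; [exact: linearP | exact: counit_bimod]. Qed.

Lemma conv_balanced f g : bimod_map f -> bimod_map g ->
  balanced (fun b X => t b * X) (fun b Y => s b * Y) (fun X Y => f X * g Y).
Proof.
move=> fB gB; split=> *.
- by rewrite (bmapD fB) mulrDl.
- by rewrite (bmapD gB) mulrDr.
- by rewrite (bmapZ fB) (bmapZ gB) -scalerAl scalerAr.
- by rewrite !(bmapZ fB) (bmapt fB) (bmaps gB) -!scalerAl mulrA.
Qed.

Lemma lmul_ok b c : tmap_ok (fun b' (X : L) => t b' * X)
  (fun b' (Y : L) => s b' * Y) (fun Y => s b * Y) (fun Y => t c * Y).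
Proof.
split=> [a X Y|a X Y|i m|i m].
- by rewrite mulrDr scalerAr.
- by rewrite mulrDr scalerAr.
- by rewrite !mulrA src_tgtC.
- by rewrite !mulrA src_tgtC.
Qed.

Lemma rmul_ok X' Y' : tmap_ok (fun b' (X : L) => t b' * X)
  (fun b' (Y : L) => s b' * Y) (fun X => X * X') (fun Y => Y * Y').
Proof.
by split=> [a X Y|a X Y|i m|i m]; rewrite ?mulrDl ?scalerAl ?mulrA.
Qed.

Lemma comul_s b : D (s b) = s b (x) 1.
Proof.
have := comul_bimod H b 1 1; rewrite tgt1 mulr1 comul1 mulr1 => ->.
by rewrite /tmapB tmap_tmk ?mulr1 //; have := lmul_ok b 1; rewrite tgt1.
Qed.

Lemma comul_t c : D (t c) = 1 (x) t c.
Proof.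
have := comul_bimod H 1 c 1; rewrite rmorph1 mul1r comul1 mulr1 => ->.
by rewrite /tmapB tmap_tmk ?mulr1 //; have := lmul_ok 1 c; rewrite rmorph1.
Qed.

Lemma mulT_tmB u X' Y' : takeuchi u ->
  mulT u (X' (x) Y') = tmapB (fun X => X * X') (fun Y => Y * Y') u.
Proof.
move=> uT; rewrite /mulT tsum_tmk //; split=> [X X2 Y|X Y Y2|a X Y|a b X Y].
- rewrite -tsum_addf; apply: eq_tsum => m n.
  by rewrite mulrDr; exact: balDl (tmk_balanced _ _) _ _ _.
- rewrite -tsum_addf; apply: eq_tsum => m n.
  by rewrite mulrDr; exact: balDr (tmk_balanced _ _) _ _ _.
- apply: eq_tsum => m n; rewrite -!scalerAr.
  exact: balZ (tmk_balanced _ _) _ _ _.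
- have := congr1 (tmapB (fun X' => X' * (a *: X)) (fun Y' => Y' * Y)) (uT b).
  rewrite ![tmapB _ _ (tmapB _ _ _)]tsum_tmap; last first.
  + exact: tmap_balanced (rmul_ok _ _).
  + exact: tmap_balanced (rmul_ok _ _).
  move=> e; transitivity (\tsum_(m, n <- u) tmB H (m * t b * (a *: X)) (n * Y)).
    by apply: eq_tsum => m n; rewrite -scalerAr mulrA scalerAr.
  by rewrite [LHS]e; apply: eq_tsum => m n; rewrite !mulrA.
Qed.

Lemma comulMs X b : D (X * s b) = tmapB (fun Y => Y * s b) id (D X).
Proof.
rewrite comulM comul_s mulT_tmB; last exact: comul_takeuchi.
by apply: eq_tsum => m n; rewrite mulr1.
Qed.

Lemma comulMt X b : D (X * t b) = tmapB id (fun Y => Y * t b) (D X).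
Proof.
rewrite comulM comul_t mulT_tmB; last exact: comul_takeuchi.
by apply: eq_tsum => m n; rewrite mulr1.
Qed.

Lemma conv_bimod f g : bimod_map f -> bimod_map g -> bimod_map (conv f g).
Proof.
move=> fB gB; have fgB := conv_balanced fB gB; split=> [a X Y|b c X].
  rewrite /conv linearD linearZ (tsumD fgB); congr (_ + _).
  rewrite -[LHS]/((fun u : tensB H => \tsum_(X1, X2 <- u) f X1 * g X2) (a *: D X)).
  rewrite -{1}[D X]tsum_id (tsum_lin _ _ (scalerDr a)).
  rewrite (tsum_lin _ _ (tsumD fgB)) (tsum_lin _ _ (scalerDr a)).
  apply: eq_tsum => m n; rewrite tmkZ (tsum_tmk fgB).
  by rewrite (bmapZ fB) scalerAl.
rewrite /conv comul_bimod [LHS](tsum_tmap _ _ _ fgB).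
rewrite -mulrA (tsum_lin _ _ (fun x y => mulrDl x y c)) (tsum_lin _ _ (mulrDr b)).
by apply: eq_tsum => m n; rewrite (bmaps fB) (bmapt gB) !mulrA.
Qed.

Lemma conv_epsl f : bimod_map f -> conv eps f =1 f.
Proof.
move=> fB X; rewrite -{2}[X](counitl H) (tsum_lin _ _ (bmapD fB)).
by apply: eq_tsum => m n; rewrite (bmaps fB).
Qed.

Lemma conv_epsr f : bimod_map f -> conv f eps =1 f.
Proof.
move=> fB X; rewrite -{2}[X](counitr H) (tsum_lin _ _ (bmapD fB)).
by apply: eq_tsum => m n; rewrite (bmapt fB).
Qed.

Lemma convA f g h : bimod_map f -> bimod_map g -> bimod_map h ->
  conv f (conv g h) =1 conv (conv f g) h.
Proof.
move=> fB gB hB X; have ghB := conv_balanced gB hB.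
pose gh (w : tensB H) := \tsum_(Y, Z <- w) g Y * h Z.
have ghs b w : gh (tmapB (fun Y => s b * Y) id w) = b * gh w.
  rewrite [LHS](tsum_tmap _ _ _ ghB) (tsum_lin _ _ (mulrDr b)).
  by apply: eq_tsum => m n; rewrite (bmaps gB) mulrA.
have ghD : {morph gh : u v / u + v} := tsumD ghB.
have ghZ a w : gh (a *: w) = a *: gh w.
  rewrite -{1}[w]tsum_id (tsum_lin _ _ (scalerDr a)) (tsum_lin _ _ ghD).
  rewrite (tsum_lin _ _ (scalerDr a)); apply: eq_tsum => m n.
  by rewrite tmkZ [LHS](tsum_tmk ghB) (bmapZ gB) scalerAl.
have FB : balanced (fun b X => t b * X)
    (fun b (w : tensB H) => tmapB (fun Y => s b * Y) id w)
    (fun X w => f X * gh w).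
  split=> *.
  - by rewrite (bmapD fB) mulrDl.
  - by rewrite ghD mulrDr.
  - by rewrite (bmapZ fB) ghZ -scalerAl scalerAr.
  - by rewrite !(bmapZ fB) (bmapt fB) ghs -!scalerAl mulrA.
pose F (u : tensB3 H) := \tsum_(X1, w <- u) f X1 * gh w.
have FD : {morph F : u v / u + v} := tsumD FB.
have := congr1 F (comulA H X).
rewrite !(tsum_lin _ _ FD) => e; transitivity
    (\tsum_(X1, X2 <- D X) F (tmB3 X1 (D X2))).
  by apply: eq_tsum => m n; rewrite [RHS](tsum_tmk FB).
rewrite -e; apply: eq_tsum => m n; rewrite (tsum_lin _ _ FD).
rewrite (tsum_lin _ _ (fun x y => mulrDl x y (h n))).
by apply: eq_tsum => m' n'; rewrite [LHS](tsum_tmk FB) [gh _](tsum_tmk ghB) mulrA.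
Qed.

Lemma conv_st f g : bimod_map f -> bimod_map g ->
  (forall X b, f (X * s b) = f (X * t b)) ->
  forall X b, conv f g (X * s b) = conv f (fun Y => g (Y * s b)) X.
Proof.
move=> fB gB fst X b; have fgB := conv_balanced fB gB.
rewrite /conv comulMs [LHS](tsum_tmap _ _ _ fgB).
under eq_tsum do rewrite fst.
have := congr1 (fun u : tensB H => \tsum_(X1, X2 <- u) f X1 * g X2)
  (comul_takeuchi H X b).
by rewrite !(tsum_tmap _ _ _ fgB).
Qed.

Lemma conv_t f g : bimod_map f -> bimod_map g ->
  forall X b, conv f g (X * t b) = conv f (fun Y => g (Y * t b)) X.
Proof.
move=> fB gB X b; have fgB := conv_balanced fB gB.
by rewrite /conv comulMt [LHS](tsum_tmap _ _ _ fgB).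
Qed.

Lemma eps_st X b : eps (X * s b) = eps (X * t b).
Proof.
have epss : eps (s b) = b by rewrite -[s b]mulr1 (bmaps eps_bimod) counit1 mulr1.
by rewrite -counitMt epss.
Qed.

Lemma rmap_bimod g Z : bimod_map g -> bimod_map (fun Y => g (Y * Z)).
Proof.
move=> gB; split=> [a X Y|b c X]; last by rewrite -mulrA gB.2.
by rewrite mulrDl -scalerAl gB.1.
Qed.

Lemma conv_1 f g : bimod_map f -> bimod_map g -> conv f g 1 = f 1 * g 1.
Proof.
by move=> fB gB; rewrite /conv comul1 [LHS](tsum_tmk (conv_balanced fB gB)).
Qed.

Lemma conv_inverse_C1 (U : C1) g : bimod_map g -> conv_inverse U g ->
  g 1 = 1 /\ forall X b, g (X * s b) = g (X * t b).
Proof.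
case: U => f fB _ f1 fst gB /= [fg gf]; split=> [|X b].
  by have := fg 1; rewrite conv_1 // f1 mul1r counit1.
have gsB := rmap_bimod (s b) gB; have gtB := rmap_bimod (t b) gB.
rewrite -[LHS](conv_epsl gsB) -[RHS](conv_epsl gtB).
have -> : conv eps (fun Y => g (Y * s b)) X =
          conv (conv g f) (fun Y => g (Y * s b)) X.
  by apply: eq_tsum => m n; rewrite gf.
have -> : conv eps (fun Y => g (Y * t b)) X =
          conv (conv g f) (fun Y => g (Y * t b)) X.
  by apply: eq_tsum => m n; rewrite gf.
rewrite -!convA //; apply: eq_tsum => m n; congr (_ * _).
by rewrite -conv_st // -conv_t // !fg eps_st.
Qed.

Lemma eps_invertible : conv_invertible eps.
Proof. by exists eps; [exact: eps_bimod | split; exact: conv_epsl eps_bimod]. Qed.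

Definition C1_one : C1 := MkC1 eps_bimod eps_invertible (counit1 H) eps_st.

Definition C1_inv_fun (U : C1) : L -> B := s2val (cid2 (C1_invertible U)).

Lemma C1_inv_bimod (U : C1) : bimod_map (C1_inv_fun U).
Proof. exact: s2valP (cid2 (C1_invertible U)). Qed.

Lemma C1_inv_inverse (U : C1) : conv_inverse U (C1_inv_fun U).
Proof. exact: s2valP' (cid2 (C1_invertible U)). Qed.

Lemma C1_inv_invertible (U : C1) : conv_invertible (C1_inv_fun U).
Proof.
by exists U; [exact: C1_bimod | case: (C1_inv_inverse U) => ? ?; split].
Qed.

Definition C1_inv (U : C1) : C1 :=
  let P := conv_inverse_C1 (C1_inv_bimod U) (C1_inv_inverse U) in
  MkC1 (C1_inv_bimod U) (C1_inv_invertible U) (proj1 P) (proj2 P).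

Lemma conv_invM (P Q P' Q' : C1) :
  conv P P' =1 eps -> conv Q Q' =1 eps ->
  conv (conv P Q) (conv Q' P') =1 eps.
Proof.
move=> PP QQ X; have [bP bQ] := (C1_bimod P, C1_bimod Q).
have [bP' bQ'] := (C1_bimod P', C1_bimod Q').
rewrite -convA //; last exact: conv_bimod.
rewrite -PP; apply: eq_tsum => m n; congr (_ * _).
rewrite convA // -[RHS](conv_epsl bP').
by apply: eq_tsum => m' n'; rewrite QQ.
Qed.

Lemma C1_mul_bimod (U V : C1) : bimod_map (conv U V).
Proof. by apply: conv_bimod; exact: C1_bimod. Qed.

Lemma C1_mul_invertible (U V : C1) : conv_invertible (conv U V).
Proof.
exists (conv (C1_inv V) (C1_inv U)); first exact: C1_mul_bimod.
have [UI1 UI2] := C1_inv_inverse U; have [VI1 VI2] := C1_inv_inverse V.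
by split; apply: conv_invM.
Qed.

Lemma C1_mul_1 (U V : C1) : conv U V 1 = 1.
Proof. by rewrite conv_1 ?C1_1 ?mul1r //; exact: C1_bimod. Qed.

Lemma C1_mul_st (U V : C1) X b : conv U V (X * s b) = conv U V (X * t b).
Proof.
have [bU bV] := (C1_bimod U, C1_bimod V).
rewrite conv_st //; last exact: C1_st.
by rewrite conv_t //; apply: eq_tsum => m n; rewrite C1_st.
Qed.

Definition C1_mul (U V : C1) : C1 :=
  MkC1 (C1_mul_bimod U V) (C1_mul_invertible U V) (C1_mul_1 U V) (C1_mul_st U V).

HB.instance Definition _ := gen_eqMixin C1.
HB.instance Definition _ := gen_choiceMixin C1.

Lemma C1_mulA : associative C1_mul.
Proof. by move=> U V W; apply: C1_eq => X; apply: convA; exact: C1_bimod. Qed.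
Lemma C1_mul1 : left_id C1_one C1_mul.
Proof. by move=> U; apply: C1_eq; apply: conv_epsl; exact: C1_bimod. Qed.
Lemma C1_1mul : right_id C1_one C1_mul.
Proof. by move=> U; apply: C1_eq; apply: conv_epsr; exact: C1_bimod. Qed.
Lemma C1_mulV : left_inverse C1_one C1_inv C1_mul.
Proof. by move=> U; apply: C1_eq => X; exact: (C1_inv_inverse U).2. Qed.
Lemma C1_Vmul : right_inverse C1_one C1_inv C1_mul.
Proof. by move=> U; apply: C1_eq => X; exact: (C1_inv_inverse U).1. Qed.

HB.instance Definition _ := isGroup.Build C1
  C1_mulA C1_mul1 C1_1mul C1_mulV C1_Vmul.

Lemma C1_mulE (U V : C1) : C1_fun (U * V)%g = conv U V.
Proof. by []. Qed.

Lemma C1_oneE : C1_fun 1%g = eps.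
Proof. by []. Qed.

Local Notation "X (x)e Y" := (tmBe H X Y) (at level 40).

Definition bimod_map2 (G : tensBe H -> B) : Prop :=
  linear G /\ forall b c u, G (actBe b c u) = b * G u * c.

(* For bimodule maps f and g the nested sum does not depend on the
   representations chosen, because comul takes values in the Takeuchi product. *)
Definition conv2 (f g : tensBe H -> B) (u : tensBe H) : B :=
  \tsum_(X, Y <- u) \tsum_(X1, X2 <- D X) \tsum_(Y1, Y2 <- D Y)
    f (X1 (x)e Y1) * g (X2 (x)e Y2).

Definition triv2 (u : tensBe H) : B := \tsum_(X, Y <- u) eps (X * Y).

Definition conv2_invertible (f : tensBe H -> B) : Prop :=
  exists2 g, bimod_map2 g & conv2 f g =1 triv2 /\ conv2 g f =1 triv2.

Record Z2 (G : tensBe H -> B) : Prop := MkZ2 {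
  Z2_bimod : bimod_map2 G;
  Z2_invertible : conv2_invertible G;
  Z2_cocycle : forall X Y Z,
    G (X (x)e \tsum_(Y1, Y2 <- D Y) \tsum_(Z1, Z2 <- D Z)
                s (G (Y1 (x)e Z1)) * Y2 * Z2) =
    G ((\tsum_(X1, X2 <- D X) \tsum_(Y1, Y2 <- D Y)
                s (G (X1 (x)e Y1)) * X2 * Y2) (x)e Z);
  Z2_1l : forall X, G (1 (x)e X) = eps X;
  Z2_1r : forall X, G (X (x)e 1) = eps X;
  Z2_st : forall X Y b, G (X (x)e (Y * s b)) = G (X (x)e (Y * t b)) }.

Definition coboundary (U : C1) (u : tensBe H) : B :=
  let V : C1 := (U^-1)%g in
  \tsum_(X, Y <- u) \tsum_(X1, X2 <- D X) \tsum_(Y1, Y2 <- D Y)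
    V (X1 * t (V Y1)) * U (X2 * Y2).

Definition Z1 : {pred C1} :=
  [pred U : C1 | `[< forall X Y, coboundary U (X (x)e Y) = eps (X * Y) >]].

(* The triple (X1, X2, X3) runs over (id (x) comul) (comul X), and likewise
   (Y1, Y2, Y3). *)
Definition twist (G : tensBe H -> B) (U : C1) (u : tensBe H) : B :=
  let V : C1 := (U^-1)%g in
  \tsum_(X, Y <- u)
    \tsum_(X1, X' <- D X) \tsum_(X2, X3 <- D X')
    \tsum_(Y1, Y' <- D Y) \tsum_(Y2, Y3 <- D Y')
      V (X1 * t (V Y1)) * G (X2 (x)e Y2) * U (X3 * Y3).

Definition H2 : set (set (tensBe H -> B)) :=
  [set O | exists2 G, Z2 G & O = [set twist G U | U in [set: C1]]]%classic.

Record vertical_bisection (sg : L -> B) : Prop := VerticalBisection {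
  vb_linear : linear sg;
  vb_1 : sg 1 = 1;
  vb_t : forall b X, sg (t b * X) = sg X * b;
  vb_s : forall b, sg (s b) = b;
  vb_Mt : forall X Y, sg (X * Y) = sg (X * t (sg Y));
  vb_Ms : forall X Y, sg (X * Y) = sg (X * s (sg Y)) }.

Definition vb_mul (sg tau : L -> B) (X : L) : B :=
  \tsum_(X1, X2 <- D X) sg (s (tau X1) * X2).

End Cochains.

Arguments C1_fun {k B L H} _ _.
Arguments Z1 {k B L} H.
Arguments H2 {k B L} H.

(* Main.v *)
Require Import Defs.
From HB Require Import structures.
From mathcomp Require Import all_boot all_order all_algebra.
From mathcomp Require Import boolp classical_sets.

Set Implicit Arguments.
Unset Strict Implicit.
Unset Printing Implicit Defensive.

Import GRing.Theory.

Local Open Scope ring_scope.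

(** Write E for the tensor square of L over B^e, and X.Y for the product
      X.Y = s (G (X1, Y1)) X2 Y2
    on L attached to a bimodule map G : E -> B.  Since G (X, Y) = eps (X.Y),
    the map G is recovered from the product, and the 2-cocycle condition on G
    says exactly that this product is associative.  A cochain U acts on L by
      phi_U (X) = s (U X1) X2,
    a bijection with inverse phi_(U^-1) which commutes with multiplication by
    s b and t b on either side.  The product attached to the twist of G by U is
      phi_U (phi_U^-1 X . phi_U^-1 Y),
    the transport of the product of G along phi_U.  So it is again associative
    and unital, and twisting by U and then by V is twisting by the convolution
    product U V, because phi_(U V) = phi_V o phi_U.  The coboundary of U is the
    twist of the trivial cocycle, whose product is the multiplication of L;
    hence the coboundary is trivial exactly when phi_U is multiplicative, and
    applying eps to phi_U X phi_U Y turns this into U (X Y) = U (X s (U Y)),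
    the defining identity of a vertical bisection.

    These facts take place in two B-corings, L and E, with the multiplication
    E -> L as a coring map ([tsum_comul_mulBe]).  In any B-coring C the
    convolution algebra of bimodule maps f : C -> B acts on C by
    x |-> f (x1) . x2 ([translate]); this action is contravariant for
    convolution ([translate_conv]) and f is recovered from it by the counit
    ([eps_translate]).  The twist factors as a convolution product in E,
      twist G U = (ext_square U^-1) * G * (U o multiplication),
    whose first factor acts on E as phi_U^-1 on both legs
    ([translate_ext_square]) and whose last one becomes phi_U after
    multiplication ([mulBe_translate]); together they give the transport
    formula [gprod_twist].  Convolution invertibility of the twist is visible
    on the same factorization. *)

(** * Sums over balanced tensor products *)

Section Tsum.
Variables (k : fieldType) (M N : lmodType k) (I : Type).
Variables (r : I -> M -> M) (l : I -> N -> N).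

Lemma linear_morphD (U V : lmodType k) (f : U -> V) :
  linear f -> {morph f : x y / x + y}.
Proof. by move=> fl x y; rewrite -[x]scale1r fl !scale1r. Qed.

Lemma linear_morphZ (U V : lmodType k) (f : U -> V) :
  linear f -> forall a, {morph f : x / a *: x}.
Proof.
move=> fl a x; have fD := linear_morphD fl.
have f0 : f 0 = 0 by apply: (@addrI _ (f 0)); rewrite -fD !addr0.
by rewrite -[a *: x]addr0 fl f0 addr0.
Qed.

Lemma tsumZ (V : zmodType) (f : M -> N -> V) a (u : tens r l) :
  balanced r l f -> tsum f (a *: u) = \tsum_(m, n <- u) f (a *: m) n.
Proof.
move=> fB; rewrite -{1}[u]tsum_id (tsum_lin _ _ (scalerDr a)).
rewrite (tsum_lin _ _ (tsumD fB)); apply: eq_tsum => m n.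
by rewrite tmkZ (tsum_tmk fB).
Qed.

Lemma tsum_exchange (M' N' : lmodType k) (I' : Type) (r' : I' -> M' -> M')
    (l' : I' -> N' -> N') (V : zmodType) (f : M -> N -> M' -> N' -> V)
    (u : tens r l) (v : tens r' l') :
  \tsum_(m, n <- u) \tsum_(m', n' <- v) f m n m' n' =
  \tsum_(m', n' <- v) \tsum_(m, n <- u) f m n m' n'.
Proof. exact: exchange_big. Qed.

Lemma tsum_balanced (M' N' : lmodType k) (I' : Type) (r' : I' -> M' -> M')
    (l' : I' -> N' -> N') (V : zmodType) (f : M -> N -> M' -> N' -> V)
    (v : tens r' l') :
  (forall m' n', balanced r l (fun m n => f m n m' n')) ->
  balanced r l (fun m n => \tsum_(m', n' <- v) f m n m' n').
Proof.
move=> fB; split=> *; rewrite -?tsum_addf; apply: eq_tsum => m' n'.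
- exact: balDl (fB _ _) _ _ _.
- exact: balDr (fB _ _) _ _ _.
- exact: balZ (fB _ _) _ _ _.
- exact: balB (fB _ _) _ _ _ _.
Qed.

Lemma morph_balanced (V W : zmodType) (h : V -> W) (f : M -> N -> V) :
  {morph h : x y / x + y} -> balanced r l f -> balanced r l (fun m n => h (f m n)).
Proof.
move=> hD fB; split=> *.
- by rewrite (balDl fB) hD.
- by rewrite (balDr fB) hD.
- by rewrite (balZ fB).
- by rewrite (balB fB).
Qed.

Lemma tsum_linear (V : lmodType k) (f : M -> N -> V) :
  balanced r l f -> (forall a m n, f (a *: m) n = a *: f m n) ->
  linear (fun u : tens r l => tsum f u).
Proof.
move=> fB fZ a u v; rewrite (tsumD fB) (tsumZ _ _ fB); congr (_ + _).
by rewrite (tsum_lin _ _ (scalerDr a)); apply: eq_tsum.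
Qed.

End Tsum.

(** * Corings and their convolution algebras *)

Section Coring.
Variables (k : fieldType) (B : algType k).

Definition bimap (C : lmodType k) (la ra : B -> C -> C) (f : C -> B) : Prop :=
  [/\ linear f, forall b x, f (la b x) = b * f x & forall c x, f (ra c x) = f x * c].

(** Balance over B in both slots of a triple: what is needed to sum F over an
    iterated coproduct. *)
Definition balanced3 (C : lmodType k) (la ra : B -> C -> C) (V : zmodType)
    (F : C -> C -> C -> V) : Prop :=
  (forall z, balanced ra la (fun x y => F x y z)) /\
  (forall x, balanced ra la (fun y z => F x y z)).

(** The right action is a family ra of operators on the left of x, so that it
    reverses products, as multiplication by a target does. *)
Record bimodule (C : lmodType k) (la ra : B -> C -> C) : Prop := Bimodule {
  bm_la : forall b, linear (la b);
  bm_ra : forall c, linear (ra c);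
  bm_laD : forall b b' x, la (b + b') x = la b x + la b' x;
  bm_raD : forall c c' x, ra (c + c') x = ra c x + ra c' x;
  bm_laZ : forall a b x, la (a *: b) x = a *: la b x;
  bm_raZ : forall a c x, ra (a *: c) x = a *: ra c x;
  bm_laM : forall b b' x, la (b * b') x = la b (la b' x);
  bm_raM : forall c c' x, ra (c * c') x = ra c' (ra c x);
  bm_lara : forall b c x, la b (ra c x) = ra c (la b x) }.

(** Coassociativity is stated for sums of triply balanced functions into an
    arbitrary group, which is the universal property of the triple tensor
    product; this is the form in which it is both proved for the tensor square
    and used in Sweedler computations. *)
Record coring (C : lmodType k) (la ra : B -> C -> C) (Delta : C -> tens ra la)
    (eps : C -> B) : Prop := Coring {
  cor_bimodule : bimodule la ra;
  cor_Delta : linear Delta;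
  cor_Delta_la : forall b x, Delta (la b x) = tmap (la b) id (Delta x);
  cor_Delta_ra : forall c x, Delta (ra c x) = tmap id (ra c) (Delta x);
  cor_eps : bimap la ra eps;
  cor_assoc : forall (V : zmodType) (F : C -> C -> C -> V), balanced3 la ra F ->
    forall x, \tsum_(x1, x2 <- Delta x) \tsum_(x11, x12 <- Delta x1) F x11 x12 x2 =
              \tsum_(x1, x2 <- Delta x) \tsum_(x21, x22 <- Delta x2) F x1 x21 x22;
  cor_counitl : forall x, \tsum_(x1, x2 <- Delta x) la (eps x1) x2 = x;
  cor_counitr : forall x, \tsum_(x1, x2 <- Delta x) ra (eps x2) x1 = x }.

Section Balanced.
Variables (C : lmodType k) (la ra : B -> C -> C) (bC : bimodule la ra).
Variables (f : C -> B) (fB : bimap la ra f).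

Lemma bimapD : {morph f : x y / x + y}.
Proof. by case: fB => /linear_morphD. Qed.

Lemma bimapZ a : {morph f : x / a *: x}.
Proof. by case: fB => /linear_morphZ. Qed.

Lemma la_balanced : balanced ra la (fun x y => la (f x) y).
Proof.
have [_ fl fr] := fB; split=> *.
- by rewrite bimapD (bm_laD bC).
- by rewrite (linear_morphD (bm_la bC _)).
- by rewrite bimapZ (bm_laZ bC) (linear_morphZ (bm_la bC _)).
- by rewrite !bimapZ fr scalerAl (bm_laM bC).
Qed.

Lemma ra_balanced : balanced ra la (fun x y => ra (f y) x).
Proof.
have [_ fl fr] := fB; split=> *.
- by rewrite (linear_morphD (bm_ra bC _)).
- by rewrite bimapD (bm_raD bC).
- by rewrite bimapZ (bm_raZ bC) (linear_morphZ (bm_ra bC _)).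
- by rewrite fl (bm_raM bC) !(linear_morphZ (bm_ra bC _)).
Qed.

Lemma mul_balanced (g : C -> B) : bimap la ra g ->
  balanced ra la (fun x y => f x * g y).
Proof.
have [_ fl fr] := fB; move=> [/[dup] /linear_morphD gD /linear_morphZ gZ gl _].
split=> *; rewrite ?bimapD ?gD ?mulrDl ?mulrDr //.
- by rewrite bimapZ gZ -scalerAl scalerAr.
- by rewrite !bimapZ fr gl -!scalerAl mulrA.
Qed.

End Balanced.

Section Iterated.
Variables (C : lmodType k) (la ra : B -> C -> C) (Delta : C -> tens ra la).
Hypothesis Delta_linear : linear Delta.
Hypothesis Delta_la : forall b x, Delta (la b x) = tmap (la b) id (Delta x).
Hypothesis Delta_ra : forall c x, Delta (ra c x) = tmap id (ra c) (Delta x).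
Variables (V : zmodType) (F : C -> C -> C -> V) (FB : balanced3 la ra F).

(** Only linearity and bimodule compatibility of Delta enter here, so that the
    two lemmas are available while a coring structure is being built. *)
Lemma iter_comull_balanced :
  balanced ra la (fun x z => \tsum_(x1, x2 <- Delta x) F x1 x2 z).
Proof.
have [F12 F23] := FB; have DD := linear_morphD Delta_linear.
have DZ := linear_morphZ Delta_linear.
split=> [x x' z|x z z'|a x z|a c x z].
- by rewrite DD (tsumD (F12 z)).
- by rewrite -tsum_addf; apply: eq_tsum => x1 x2; rewrite (balDr (F23 _)).
- rewrite DZ (tsumZ _ _ (F12 z)); apply: eq_tsum => x1 x2.
  by rewrite (balZ (F12 z)) (balZ (F23 _)).
- rewrite !DZ !(tsumZ _ _ (F12 _)) Delta_ra.
  have aB : balanced ra la (fun x y => F (a *: x) y z).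
    split=> *.
    - by rewrite scalerDr (balDl (F12 _)).
    - by rewrite (balDr (F12 _)).
    - by rewrite scalerA mulrC -scalerA (balZ (F12 _)).
    - by rewrite !scalerA (balB (F12 _)).
  rewrite (tsum_tmap _ _ _ aB); apply: eq_tsum => x1 x2.
  rewrite (balZ (F12 z)) (balZ (F12 _)).
  by rewrite (balB (F23 _)).
Qed.

Lemma iter_comulr_balanced :
  balanced ra la (fun x z => \tsum_(z1, z2 <- Delta z) F x z1 z2).
Proof.
have [F12 F23] := FB; have DD := linear_morphD Delta_linear.
have DZ := linear_morphZ Delta_linear.
split=> [x x' z|x z z'|a x z|a c x z].
- by rewrite -tsum_addf; apply: eq_tsum => z1 z2; rewrite (balDl (F12 _)).
- by rewrite DD (tsumD (F23 x)).
- rewrite DZ (tsumZ _ _ (F23 x)); apply: eq_tsum => z1 z2.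
  by rewrite (balZ (F12 _)).
- rewrite Delta_la (tsum_tmap _ _ _ (F23 _)); apply: eq_tsum => z1 z2.
  by rewrite (balB (F12 _)).
Qed.

End Iterated.

Section Theory.
Variables (C : lmodType k) (la ra : B -> C -> C) (Delta : C -> tens ra la).
Variables (eps : C -> B) (cC : coring Delta eps).
Local Notation bim := (bimap la ra).
Let bC := cor_bimodule cC.

Definition cor_conv (f g : C -> B) (x : C) : B :=
  \tsum_(x1, x2 <- Delta x) f x1 * g x2.

(** The convolution algebra of C acts on C through its left coaction on
    itself; composing with this action realizes convolution as composition of
    maps ([bimap_translate]). *)
Definition translate (f : C -> B) (x : C) : C :=
  \tsum_(x1, x2 <- Delta x) la (f x1) x2.

Lemma tsum_Delta_la (V : zmodType) (F : C -> C -> V) b x : balanced ra la F ->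
  \tsum_(x1, x2 <- Delta (la b x)) F x1 x2 =
  \tsum_(x1, x2 <- Delta x) F (la b x1) x2.
Proof. by move=> FB; rewrite (cor_Delta_la cC) (tsum_tmap _ _ _ FB). Qed.

Lemma tsum_Delta_ra (V : zmodType) (F : C -> C -> V) c x : balanced ra la F ->
  \tsum_(x1, x2 <- Delta (ra c x)) F x1 x2 =
  \tsum_(x1, x2 <- Delta x) F x1 (ra c x2).
Proof. by move=> FB; rewrite (cor_Delta_ra cC) (tsum_tmap _ _ _ FB). Qed.

Lemma tsum_DeltaD (V : zmodType) (F : C -> C -> V) : balanced ra la F ->
  {morph (fun x => tsum F (Delta x)) : x y / x + y}.
Proof. by move=> FB x y; rewrite (linear_morphD (cor_Delta cC)) (tsumD FB). Qed.

Lemma tsum_DeltaZ (V : zmodType) (F : C -> C -> V) a x : balanced ra la F ->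
  \tsum_(x1, x2 <- Delta (a *: x)) F x1 x2 =
  \tsum_(x1, x2 <- Delta x) F (a *: x1) x2.
Proof. by move=> FB; rewrite (linear_morphZ (cor_Delta cC)) (tsumZ _ _ FB). Qed.

Lemma translateD f : bim f -> {morph translate f : x y / x + y}.
Proof. by move=> /(la_balanced bC)/tsum_DeltaD. Qed.

Lemma translate_linear f : bim f -> linear (translate f).
Proof.
move=> fB a x y; rewrite translateD //; congr (_ + _).
rewrite /translate (tsum_DeltaZ _ _ (la_balanced bC fB)) (tsum_lin _ _ (scalerDr a)).
by apply: eq_tsum => x1 x2; rewrite (bimapZ fB) (bm_laZ bC).
Qed.

Lemma translate_la f b x : bim f -> translate f (la b x) = la b (translate f x).
Proof.
move=> fB; have [_ fl _] := fB; rewrite /translate (tsum_Delta_la _ _ (la_balanced bC fB)).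
rewrite (tsum_lin _ _ (linear_morphD (bm_la bC b))); apply: eq_tsum => x1 x2.
by rewrite fl (bm_laM bC).
Qed.

Lemma translate_ra f c x : bim f -> translate f (ra c x) = ra c (translate f x).
Proof.
move=> fB; rewrite /translate (tsum_Delta_ra _ _ (la_balanced bC fB)).
rewrite (tsum_lin _ _ (linear_morphD (bm_ra bC c))); apply: eq_tsum => x1 x2.
by rewrite (bm_lara bC).
Qed.

Lemma bimap_translate f g x : bim g -> g (translate f x) = cor_conv f g x.
Proof.
move=> gB; have [_ gl _] := gB.
by rewrite /translate (tsum_lin _ _ (bimapD gB)); apply: eq_tsum => x1 x2; rewrite gl.
Qed.

Lemma cor_conv_bimap f g : bim f -> bim g -> bim (cor_conv f g).
Proof.
move=> fB gB; have [gl glm grm] := gB.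
split=> [a x y|b x|c x]; rewrite -!(bimap_translate f _ gB).
- by rewrite (translate_linear fB) gl.
- by rewrite (translate_la _ _ fB) glm.
- by rewrite (translate_ra _ _ fB) grm.
Qed.

(** The action uses the leftmost leg only, hence is colinear on the right:
    coassociativity moves it inside the first leg. *)
Lemma tsum_Delta_translate (V : zmodType) (F : C -> C -> V) f x :
  bim f -> balanced ra la F ->
  \tsum_(x1, x2 <- Delta (translate f x)) F x1 x2 =
  \tsum_(x1, x2 <- Delta x) F (translate f x1) x2.
Proof.
move=> fB FB; rewrite {1}/translate (tsum_lin _ _ (tsum_DeltaD FB)).
under eq_tsum do rewrite (tsum_Delta_la _ _ FB).
rewrite -(cor_assoc cC (F := fun x y z => F (la (f x) y) z)); last first.
  split=> [z|y].
    apply: (morph_balanced (h := F^~ z) _ (la_balanced bC fB)) => y y'.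
    by rewrite (balDl FB).
  split=> *.
  - by rewrite (linear_morphD (bm_la bC _)) (balDl FB).
  - by rewrite (balDr FB).
  - by rewrite (linear_morphZ (bm_la bC _)) (balZ FB).
  - by rewrite !(linear_morphZ (bm_la bC _)) (bm_lara bC) (balB FB).
apply: eq_tsum => x1 x2.
rewrite /translate (tsum_lin (h := F^~ x2)) // => y y'.
by rewrite (balDl FB).
Qed.

Lemma translate_conv f g x : bim f -> bim g ->
  translate (cor_conv f g) x = translate g (translate f x).
Proof.
move=> fB gB; rewrite [RHS](tsum_Delta_translate _ fB (la_balanced bC gB)).
by apply: eq_tsum => x1 x2; rewrite -bimap_translate.
Qed.

Lemma cor_convA f g h x : bim f -> bim g -> bim h ->
  cor_conv f (cor_conv g h) x = cor_conv (cor_conv f g) h x.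
Proof.
move=> fB gB hB; rewrite -[LHS]bimap_translate; last exact: cor_conv_bimap.
by rewrite -!bimap_translate // translate_conv.
Qed.

Lemma translate_eps x : translate eps x = x.
Proof. exact: (cor_counitl cC). Qed.

Lemma cor_conv_epsl f x : bim f -> cor_conv eps f x = f x.
Proof. by move=> fB; rewrite -bimap_translate // translate_eps. Qed.

Lemma cor_conv_epsr f x : bim f -> cor_conv f eps x = f x.
Proof.
move=> fB; have [_ _ fr] := fB.
rewrite -[in RHS](cor_counitr cC x) (tsum_lin _ _ (bimapD fB)).
by apply: eq_tsum => x1 x2; rewrite fr.
Qed.

Lemma eps_translate f x : bim f -> eps (translate f x) = f x.
Proof. by move=> fB; rewrite bimap_translate; [exact: cor_conv_epsr | exact: cor_eps cC]. Qed.

(** The usual inverse of a product, computed through the actions: f' undoes f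
    once g' has undone g. *)
Lemma cor_conv_inverse f f' g g' : bim f -> bim f' -> bim g -> bim g' ->
  cor_conv f f' =1 eps -> cor_conv g g' =1 eps ->
  cor_conv (cor_conv f g) (cor_conv g' f') =1 eps.
Proof.
move=> fB f'B gB g'B ff' gg' x.
rewrite -bimap_translate ?translate_conv //; last exact: cor_conv_bimap.
rewrite -bimap_translate // -(translate_conv _ gB g'B) (funext gg') translate_eps.
by rewrite bimap_translate.
Qed.

End Theory.
End Coring.

(** * A bialgebroid as a coring *)

Section Bialgebroid.
Variables (k : fieldType) (B L : algType k) (H : left_bialgebroid B L).
Local Notation s := (src H).
Local Notation t := (tgt H).
Local Notation D := (comul H).
Local Notation eps := (counit H).
Local Notation X_B := (fun b (X : L) => t b * X).
Local Notation B_X := (fun b (X : L) => s b * X).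
Local Notation balL := (balanced X_B B_X).
Local Notation "X (x)e Y" := (tmBe H X Y) (at level 40).

Lemma bimod_mapP (f : L -> B) : bimap B_X X_B f <-> bimod_map H f.
Proof.
split=> [[fl fs ft]|fB].
  by split=> // b c X; rewrite -mulrA fs ft mulrA.
by split=> [|b X|c X]; [case: fB | exact: bmaps | exact: bmapt].
Qed.

Lemma tsum_comul_st (V : zmodType) (F : L -> L -> V) X b c : balL F ->
  \tsum_(X1, X2 <- D (s b * t c * X)) F X1 X2 =
  \tsum_(X1, X2 <- D X) F (s b * X1) (t c * X2).
Proof. by move=> FB; rewrite comul_bimod [LHS](tsum_tmap _ _ _ FB). Qed.

(** The Takeuchi condition as a rule for moving a target from the right of the
    first leg to a source on the right of the second leg. *)
Lemma tsum_comul_takeuchi (V : zmodType) (F : L -> L -> V) X b : balL F ->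
  \tsum_(X1, X2 <- D X) F (X1 * t b) X2 = \tsum_(X1, X2 <- D X) F X1 (X2 * s b).
Proof.
move=> FB; have := congr1 (fun u : tensB H => tsum F u) (comul_takeuchi H X b).
by rewrite !(tsum_tmap _ _ _ FB).
Qed.

Lemma tsum_comulMs (V : zmodType) (F : L -> L -> V) X b : balL F ->
  \tsum_(X1, X2 <- D (X * s b)) F X1 X2 = \tsum_(X1, X2 <- D X) F (X1 * s b) X2.
Proof. by move=> FB; rewrite comulMs [LHS](tsum_tmap _ _ _ FB). Qed.

Lemma tsum_comulMt (V : zmodType) (F : L -> L -> V) X b : balL F ->
  \tsum_(X1, X2 <- D (X * t b)) F X1 X2 = \tsum_(X1, X2 <- D X) F X1 (X2 * t b).
Proof. by move=> FB; rewrite comulMt [LHS](tsum_tmap _ _ _ FB). Qed.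

Lemma tsum_comulM (V : zmodType) (F : L -> L -> V) X Y : balL F ->
  \tsum_(Z1, Z2 <- D (X * Y)) F Z1 Z2 =
  \tsum_(X1, X2 <- D X) \tsum_(Y1, Y2 <- D Y) F (X1 * Y1) (X2 * Y2).
Proof.
move=> FB; rewrite comulM tsum_exchange (tsum_lin _ _ (tsumD FB)).
apply: eq_tsum => Y1 Y2; rewrite (tsum_lin _ _ (tsumD FB)).
by apply: eq_tsum => X1 X2; exact: (tsum_tmk FB).
Qed.

Lemma tsum_comul1 (V : zmodType) (F : L -> L -> V) : balL F ->
  \tsum_(X1, X2 <- D 1) F X1 X2 = F 1 1.
Proof. by move=> FB; rewrite comul1 [LHS](tsum_tmk FB). Qed.

(** The element identity for the coproduct becomes the functional one by
    summing F over the triple tensor product, one leg at a time. *)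
Lemma comul_coassoc (V : zmodType) (F : L -> L -> L -> V) :
  balanced3 B_X X_B F -> forall X,
  \tsum_(X1, X2 <- D X) \tsum_(X11, X12 <- D X1) F X11 X12 X2 =
  \tsum_(X1, X2 <- D X) \tsum_(X21, X22 <- D X2) F X1 X21 X22.
Proof.
move=> [F12 F23] X.
pose G X (w : tensB H) := \tsum_(Y, Z <- w) F X Y Z.
have GB : balanced X_B (fun b (w : tensB H) => tmapB (fun Y => s b * Y) id w) G.
  split=> [Y Y' w|Y w w'|a Y w|a b Y w]; rewrite /G.
  - by rewrite -tsum_addf; apply: eq_tsum => m n; rewrite (balDl (F12 _)).
  - exact: (tsumD (F23 _)).
  - rewrite (tsumZ _ _ (F23 _)); apply: eq_tsum => m n.
    exact: (balZ (F12 _)).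
  - rewrite [RHS](tsum_tmap _ _ _ (F23 _)); apply: eq_tsum => m n.
    exact: (balB (F12 _)).
have := congr1 (fun u : tensB3 H => tsum G u) (comulA H X).
rewrite !(tsum_lin _ _ (tsumD GB)) => e.
transitivity (\tsum_(X1, X2 <- D X) tsum G (tmB3 X1 (D X2))); last first.
  by apply: eq_tsum => m n; exact: (tsum_tmk GB).
rewrite -e; apply: eq_tsum => m n; rewrite (tsum_lin _ _ (tsumD GB)).
apply: eq_tsum => m' n'; rewrite [RHS](tsum_tmk GB).
exact/esym/(tsum_tmk (F23 _)).
Qed.

Lemma L_bimodule : bimodule B_X X_B.
Proof.
split.
- by move=> b a X Y; rewrite mulrDr scalerAr.
- by move=> b a X Y; rewrite mulrDr scalerAr.
- by move=> b b' X; rewrite linearD mulrDl.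
- by move=> b b' X; rewrite linearD mulrDl.
- by move=> a b X; rewrite linearZ scalerAl.
- by move=> a b X; rewrite linearZ scalerAl.
- by move=> b b' X; rewrite rmorphM mulrA.
- by move=> b b' X; rewrite tgtM mulrA.
- by move=> b c X; rewrite !mulrA src_tgtC.
Qed.

Lemma L_coring : coring (la := B_X) (ra := X_B) D eps.
Proof.
split.
- exact: L_bimodule.
- by move=> a X Y; rewrite linearP.
- move=> b X; have := comul_bimod H b 1 X; rewrite tgt1 mulr1 => ->.
  by apply: eq_tsum => m n; rewrite mul1r.
- move=> c X; have := comul_bimod H 1 c X; rewrite rmorph1 mul1r => ->.
  by apply: eq_tsum => m n; rewrite mul1r.
- exact/bimod_mapP/eps_bimod.
- exact: comul_coassoc.
- exact: counitl.
- exact: counitr.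
Qed.

(** * The tensor square over B^e as a coring *)

Local Notation E := (tensBe H).
Definition laE (b : B) (u : E) : E := actBe b 1 u.
Definition raE (c : B) (u : E) : E := actBe 1 c u.
Local Notation balE := (balanced raE laE).

Definition balancedBe (V : zmodType) (f : L -> L -> V) :=
  balanced (fun (ab : B * B) (X : L) => X * s ab.1 * t ab.2)
           (fun (ab : B * B) (Y : L) => s ab.1 * t ab.2 * Y) f.

Lemma tmBe_bal : balancedBe (fun X Y => X (x)e Y).
Proof. exact: tmk_balanced. Qed.

Lemma tmBe_s X Y b : (X * s b) (x)e Y = X (x)e (s b * Y).
Proof.
have := balB tmBe_bal 1 (b, 1) X Y.
by rewrite /= !scale1r tgt1 !mulr1.
Qed.

Lemma tmBe_t X Y b : (X * t b) (x)e Y = X (x)e (t b * Y).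
Proof.
have := balB tmBe_bal 1 (1, b) X Y.
by rewrite /= !scale1r rmorph1 !mulr1 mul1r.
Qed.

Lemma actBe_ok b c : tmap_ok (fun (ab : B * B) (X : L) => X * s ab.1 * t ab.2)
  (fun (ab : B * B) (Y : L) => s ab.1 * t ab.2 * Y) (fun X => s b * t c * X) id.
Proof. by split=> [a X Y|a X Y|i X|i X] /=; rewrite ?mulrDr ?scalerAr ?mulrA. Qed.

Lemma actBe_tmBe b c X Y : actBe b c (X (x)e Y) = (s b * t c * X) (x)e Y.
Proof. exact: (tmap_tmk (actBe_ok b c)). Qed.

Lemma actBe_linear b c : linear (actBe b c : E -> E).
Proof.
apply: tsum_linear; first exact: (tmap_balanced (actBe_ok b c)).
by move=> a m n; rewrite -scalerAr -tmkZ.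
Qed.

Lemma laE_tmBe b X Y : laE b (X (x)e Y) = (s b * X) (x)e Y.
Proof. by rewrite [LHS]actBe_tmBe tgt1 mulr1. Qed.

Lemma raE_tmBe c X Y : raE c (X (x)e Y) = (t c * X) (x)e Y.
Proof. by rewrite [LHS]actBe_tmBe rmorph1 mul1r. Qed.

Lemma tmBe_ext (V : zmodType) (f g : E -> V) :
  {morph f : x y / x + y} -> {morph g : x y / x + y} ->
  (forall X Y, f (X (x)e Y) = g (X (x)e Y)) -> forall u, f u = g u.
Proof. exact: tens_ext. Qed.

Lemma laE_D b : {morph laE b : u v / u + v}.
Proof. exact: linear_morphD (actBe_linear b 1). Qed.

Lemma raE_D b : {morph raE b : u v / u + v}.
Proof. exact: linear_morphD (actBe_linear 1 b). Qed.

Lemma laE_raE b c u : laE b (raE c u) = actBe b c u.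
Proof.
move: u; apply: tmBe_ext => [u v|u v|X Y].
- by rewrite raE_D laE_D.
- exact: linear_morphD (actBe_linear b c) _ _.
- by rewrite raE_tmBe laE_tmBe actBe_tmBe mulrA.
Qed.

Lemma raE_laE b c (u : E) : raE c (laE b u) = actBe b c u.
Proof.
move: u; apply: tmBe_ext => [u v|u v|X Y].
- by rewrite laE_D raE_D.
- exact: linear_morphD (actBe_linear b c) _ _.
- by rewrite laE_tmBe raE_tmBe actBe_tmBe mulrA src_tgtC.
Qed.

Lemma actBe1 (u : E) : actBe 1 1 u = u.
Proof.
move: u; apply: tmBe_ext => // [u v|X Y].
- exact: linear_morphD (actBe_linear 1 1) _ _.
- by rewrite actBe_tmBe rmorph1 tgt1 !mul1r.
Qed.

Lemma bimod_map2P (f : E -> B) : bimap laE raE f <-> bimod_map2 f.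
Proof.
split=> [[fl fs ft]|[fl fB]].
  by split=> // b c u; rewrite -laE_raE fs ft mulrA.
by split=> // [b u|c u]; rewrite [LHS]fB ?mulr1 ?mul1r.
Qed.

Lemma tmBeDl X X' Y : (X + X') (x)e Y = X (x)e Y + X' (x)e Y.
Proof. exact: balDl tmBe_bal _ _ _. Qed.

Lemma tmBeDr X Y Y' : X (x)e (Y + Y') = X (x)e Y + X (x)e Y'.
Proof. exact: balDr tmBe_bal _ _ _. Qed.

Lemma tmBeZl a X Y : (a *: X) (x)e Y = a *: (X (x)e Y).
Proof. exact/esym/tmkZ. Qed.

Lemma tmBeZr a X Y : X (x)e (a *: Y) = a *: (X (x)e Y).
Proof. by rewrite -tmBeZl; exact/esym/(balZ tmBe_bal). Qed.

Section Pairs.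
Variables (V : zmodType) (F : E -> E -> V) (FB : balE F).

Lemma balanced_tmBe_l Y1 Y2 : balL (fun X1 X2 => F (X1 (x)e Y1) (X2 (x)e Y2)).
Proof.
split=> *.
- by rewrite tmBeDl (balDl FB).
- by rewrite tmBeDl (balDr FB).
- by rewrite !tmBeZl (balZ FB).
- by rewrite !tmBeZl -raE_tmBe -laE_tmBe (balB FB).
Qed.

(** Unlike in the X slot, where Y1 and Y2 may be fixed, balance in the Y slot
    holds only after summation over the coproduct of X: a target passes from Y1
    to the right of X1, then by the Takeuchi condition to the right of X2, and
    from there to Y2. *)
Lemma balanced_tmBe_r X :
  balL (fun Y1 Y2 => \tsum_(X1, X2 <- D X) F (X1 (x)e Y1) (X2 (x)e Y2)).
Proof.
split=> *; rewrite -?tsum_addf.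
- by apply: eq_tsum => *; rewrite tmBeDr (balDl FB).
- by apply: eq_tsum => *; rewrite tmBeDr (balDr FB).
- by apply: eq_tsum => *; rewrite !tmBeZr (balZ FB).
under eq_tsum do rewrite tmBeZr -tmBe_t -tmBeZr.
rewrite (tsum_comul_takeuchi _ _ (balanced_tmBe_l _ _)).
by apply: eq_tsum => *; rewrite tmBe_s.
Qed.

Definition pairsum X Y : V :=
  \tsum_(X1, X2 <- D X) \tsum_(Y1, Y2 <- D Y) F (X1 (x)e Y1) (X2 (x)e Y2).

Lemma pairsumC X Y : pairsum X Y =
  \tsum_(Y1, Y2 <- D Y) \tsum_(X1, X2 <- D X) F (X1 (x)e Y1) (X2 (x)e Y2).
Proof. exact: tsum_exchange. Qed.

Lemma pairsum_st b c X Y :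
  pairsum (s b * t c * X) Y =
  \tsum_(X1, X2 <- D X) \tsum_(Y1, Y2 <- D Y)
    F (laE b (X1 (x)e Y1)) (raE c (X2 (x)e Y2)).
Proof.
rewrite pairsumC [RHS]tsum_exchange; apply: eq_tsum => Y1 Y2.
rewrite (tsum_comul_st _ _ _ (balanced_tmBe_l _ _)).
by apply: eq_tsum => *; rewrite laE_tmBe raE_tmBe.
Qed.

Lemma pairsum_bal : balancedBe pairsum.
Proof.
have xB := balanced_tmBe_l; have yB := balanced_tmBe_r.
have Dl X X' Y : pairsum (X + X') Y = pairsum X Y + pairsum X' Y.
  rewrite !pairsumC -tsum_addf; apply: eq_tsum => Y1 Y2.
  exact: (tsum_DeltaD L_coring (xB _ _)).
have Dr X Y Y' : pairsum X (Y + Y') = pairsum X Y + pairsum X Y'.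
  rewrite !pairsumC; exact: (tsum_DeltaD L_coring (yB _)).
have Z a X Y : pairsum (a *: X) Y = pairsum X (a *: Y).
  rewrite !pairsumC (tsum_DeltaZ L_coring _ _ (yB _)).
  apply: eq_tsum => Y1 Y2; rewrite (tsum_DeltaZ L_coring _ _ (xB _ _)).
  by apply: eq_tsum => X1 X2; rewrite tmBeZl tmBeZr.
split=> // a [b c] X Y /=; rewrite !Z scalerAr; move: (a *: Y) => {}Y.
rewrite !pairsumC (tsum_comul_st _ _ _ (yB _)); apply: eq_tsum => Y1 Y2.
rewrite (tsum_comulMt _ _ (xB _ _)).
have tB : balL (fun X1 X2 => F (X1 (x)e Y1) ((X2 * t c) (x)e Y2)).
  split=> *; rewrite ?mulrDl ?tmBeDl -?scalerAl ?tmBeZl.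
  - exact: balDl FB _ _ _.
  - exact: balDr FB _ _ _.
  - exact: balZ FB _ _ _.
  - by rewrite -mulrA -raE_tmBe -laE_tmBe (balB FB).
by rewrite (tsum_comulMs _ _ tB); apply: eq_tsum => *; rewrite tmBe_s tmBe_t.
Qed.

Lemma pairsumZ a X Y :
  pairsum (a *: X) Y = \tsum_(X1, X2 <- D X) \tsum_(Y1, Y2 <- D Y)
    F (a *: (X1 (x)e Y1)) (X2 (x)e Y2).
Proof.
rewrite pairsumC [RHS]tsum_exchange; apply: eq_tsum => Y1 Y2.
rewrite (tsum_DeltaZ L_coring _ _ (balanced_tmBe_l _ _)).
by apply: eq_tsum => *; rewrite tmBeZl.
Qed.

End Pairs.

Definition DeltaE (u : E) : tens raE laE :=
  \tsum_(X, Y <- u) pairsum (fun v w => tmk raE laE v w) X Y.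

Lemma tsum_DeltaE (V : zmodType) (F : E -> E -> V) X Y : balE F ->
  \tsum_(v, w <- DeltaE (X (x)e Y)) F v w = pairsum F X Y.
Proof.
move=> FB; rewrite [DeltaE _](tsum_tmk (pairsum_bal (tmk_balanced _ _))).
rewrite (tsum_lin _ _ (tsumD FB)); apply: eq_tsum => X1 X2.
rewrite (tsum_lin _ _ (tsumD FB)); apply: eq_tsum => Y1 Y2.
exact: (tsum_tmk FB).
Qed.

Lemma DeltaE_tmBe X Y :
  DeltaE (X (x)e Y) = pairsum (fun v w => tmk raE laE v w) X Y.
Proof. exact: (tsum_tmk (pairsum_bal (tmk_balanced _ _))). Qed.

Lemma DeltaE_linear : linear DeltaE.
Proof.
apply: tsum_linear => [|a X Y]; first exact: pairsum_bal (tmk_balanced _ _).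
rewrite (pairsumZ (tmk_balanced _ _)) (tsum_lin _ _ (scalerDr a)).
apply: eq_tsum => X1 X2; rewrite (tsum_lin _ _ (scalerDr a)).
by apply: eq_tsum => Y1 Y2; exact/esym/tmkZ.
Qed.

Lemma DeltaE_act b c u : DeltaE (actBe b c u) = tmap (laE b) (raE c) (DeltaE u).
Proof.
have DD := linear_morphD DeltaE_linear.
have tB : balE (fun v w => tmk raE laE (laE b v) (raE c w)).
  have rB := tmk_balanced raE laE.
  have [lD rD] := (laE_D b, raE_D c).
  have lZ a v : laE b (a *: v) = a *: laE b v.
    exact: (linear_morphZ (actBe_linear b 1)).
  have rZ a v : raE c (a *: v) = a *: raE c v.
    exact: (linear_morphZ (actBe_linear 1 c)).
  have lr b' c' v : laE b' (raE c' v) = raE c' (laE b' v).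
    by rewrite laE_raE raE_laE.
  split=> *; rewrite ?lD ?rD ?lZ ?rZ.
  - exact: balDl rB _ _ _.
  - exact: balDr rB _ _ _.
  - exact: balZ rB _ _ _.
  - by rewrite lr (balB rB) lr.
move: u; apply: tmBe_ext => [u v|u v|X Y].
- by rewrite (linear_morphD (actBe_linear b c)) DD.
- by rewrite DD [LHS](tsumD tB).
- rewrite actBe_tmBe DeltaE_tmBe (pairsum_st (tmk_balanced _ _)).
  by rewrite [RHS](tsum_DeltaE _ _ tB).
Qed.

Lemma DeltaE_laE b u : DeltaE (laE b u) = tmap (laE b) id (DeltaE u).
Proof. by rewrite DeltaE_act; apply: eq_tsum => v w; rewrite [raE _ _]actBe1. Qed.

Lemma DeltaE_raE c u : DeltaE (raE c u) = tmap id (raE c) (DeltaE u).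
Proof. by rewrite DeltaE_act; apply: eq_tsum => v w; rewrite [laE _ _]actBe1. Qed.

Lemma balanced3_tmBe (V : zmodType) (F : E -> E -> E -> V) Y1 Y2 Y3 :
  balanced3 laE raE F ->
  balanced3 B_X X_B (fun X1 X2 X3 => F (X1 (x)e Y1) (X2 (x)e Y2) (X3 (x)e Y3)).
Proof.
move=> [F12 F23]; split=> X; first exact: (balanced_tmBe_l (F12 _)).
exact: (balanced_tmBe_l (F23 _)).
Qed.

(** Coassociativity of the two legs, one after the other.  For X it applies
    with the components of Y fixed; for Y one needs the sum K over the iterated
    coproduct of X to be balanced, and each of the two slots uses one of the
    two forms of that iterated coproduct. *)
Lemma DeltaE_coassoc (V : zmodType) (F : E -> E -> E -> V) :
  balanced3 laE raE F -> forall u,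
  \tsum_(u1, u2 <- DeltaE u) \tsum_(u11, u12 <- DeltaE u1) F u11 u12 u2 =
  \tsum_(u1, u2 <- DeltaE u) \tsum_(u21, u22 <- DeltaE u2) F u1 u21 u22.
Proof.
move=> FB; have [F12 F23] := FB.
have DD := linear_morphD DeltaE_linear.
have lB := iter_comull_balanced DeltaE_linear DeltaE_raE FB.
have rB := iter_comulr_balanced DeltaE_linear DeltaE_laE FB.
apply: tmBe_ext => [u v|u v|X Y]; try by rewrite DD ?(tsumD lB) ?(tsumD rB).
pose K Y1 Y2 Y3 := \tsum_(X1, X2 <- D X) \tsum_(X21, X22 <- D X2)
  F (X1 (x)e Y1) (X21 (x)e Y2) (X22 (x)e Y3).
have KE Y1 Y2 Y3 : K Y1 Y2 Y3 = \tsum_(X1, X2 <- D X)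
    \tsum_(X11, X12 <- D X1) F (X11 (x)e Y1) (X12 (x)e Y2) (X2 (x)e Y3).
  exact/esym/(comul_coassoc (balanced3_tmBe Y1 Y2 Y3 FB)).
have KB : balanced3 B_X X_B K.
  split=> Y'.
    have -> : (fun Y1 Y2 => K Y1 Y2 Y') = fun Y1 Y2 => \tsum_(X1, X2 <- D X)
        \tsum_(X11, X12 <- D X1) F (X11 (x)e Y1) (X12 (x)e Y2) (X2 (x)e Y').
      by apply/funext => Y1; apply/funext => Y2.
    by apply: tsum_balanced => X1 X2; exact: balanced_tmBe_r (F12 _) _.
  by apply: tsum_balanced => X1 X2; exact: balanced_tmBe_r (F23 _) _.
rewrite (tsum_DeltaE _ _ lB) (tsum_DeltaE _ _ rB) !pairsumC.
transitivity (\tsum_(Y1, Y2 <- D Y) \tsum_(Y11, Y12 <- D Y1) K Y11 Y12 Y2).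
  apply: eq_tsum => Y1 Y2.
  under eq_tsum do rewrite (tsum_DeltaE _ _ (F12 _)) pairsumC.
  rewrite tsum_exchange; apply: eq_tsum => Y11 Y12.
  by rewrite KE.
rewrite (comul_coassoc KB); apply: eq_tsum => Y1 Y2.
under [RHS]eq_tsum do rewrite (tsum_DeltaE _ _ (F23 _)) pairsumC.
by rewrite [RHS]tsum_exchange.
Qed.

Lemma E_bimodule : bimodule laE raE.
Proof.
split.
- by move=> b; exact: actBe_linear.
- by move=> c; exact: actBe_linear.
- move=> b b'; apply: tmBe_ext => [u v|u v|X Y]; rewrite ?laE_D //.
    exact: addrACA.
  by rewrite !laE_tmBe linearD mulrDl tmBeDl.
- move=> c c'; apply: tmBe_ext => [u v|u v|X Y]; rewrite ?raE_D //.
    exact: addrACA.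
  by rewrite !raE_tmBe linearD mulrDl tmBeDl.
- move=> a b; apply: tmBe_ext => [u v|u v|X Y]; rewrite ?laE_D //.
    exact: scalerDr.
  by rewrite !laE_tmBe linearZ -scalerAl tmBeZl.
- move=> a c; apply: tmBe_ext => [u v|u v|X Y]; rewrite ?raE_D //.
    exact: scalerDr.
  by rewrite !raE_tmBe linearZ -scalerAl tmBeZl.
- move=> b b'; apply: tmBe_ext => [u v|u v|X Y]; rewrite ?laE_D //.
  by rewrite !laE_tmBe rmorphM mulrA.
- move=> c c'; apply: tmBe_ext => [u v|u v|X Y]; rewrite ?raE_D //.
  by rewrite !raE_tmBe tgtM mulrA.
- by move=> b c u; rewrite laE_raE raE_laE.
Qed.

Definition mulBe (u : E) : L := \tsum_(X, Y <- u) X * Y.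

Lemma mulBe_bal : balancedBe (fun X Y : L => X * Y).
Proof.
split=> *; rewrite ?mulrDl ?mulrDr //.
- by rewrite scalerCA.
- by rewrite -!scalerAl !mulrA.
Qed.

Lemma mulBe_tmBe X Y : mulBe (X (x)e Y) = X * Y.
Proof. exact: (tsum_tmk mulBe_bal). Qed.

Lemma mulBe_linear : linear mulBe.
Proof. by apply: tsum_linear mulBe_bal _ => *; rewrite scalerAl. Qed.

Lemma mulBe_laE b u : mulBe (laE b u) = s b * mulBe u.
Proof.
have mD := linear_morphD mulBe_linear.
move: u; apply: tmBe_ext => [u v|u v|X Y]; rewrite ?laE_D ?mD ?mulrDr //.
by rewrite laE_tmBe !mulBe_tmBe mulrA.
Qed.

Lemma mulBe_raE c u : mulBe (raE c u) = t c * mulBe u.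
Proof.
have mD := linear_morphD mulBe_linear.
move: u; apply: tmBe_ext => [u v|u v|X Y]; rewrite ?raE_D ?mD ?mulrDr //.
by rewrite raE_tmBe !mulBe_tmBe mulrA.
Qed.

Lemma balanced_mulBe (V : zmodType) (F : L -> L -> V) :
  balL F -> balE (fun v w => F (mulBe v) (mulBe w)).
Proof.
have [mD mZ] := (linear_morphD mulBe_linear, linear_morphZ mulBe_linear).
move=> FB; split=> *; rewrite ?mD ?mZ ?mulBe_laE ?mulBe_raE.
- exact: balDl FB _ _ _.
- exact: balDr FB _ _ _.
- exact: balZ FB _ _ _.
- exact: balB FB _ _ _ _.
Qed.

(** Multiplication is a morphism of corings, because the coproduct of L is
    multiplicative. *)
Lemma tsum_comul_mulBe (V : zmodType) (F : L -> L -> V) u : balL F ->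
  \tsum_(X1, X2 <- D (mulBe u)) F X1 X2 =
  \tsum_(v, w <- DeltaE u) F (mulBe v) (mulBe w).
Proof.
move=> FB; have FmB := balanced_mulBe FB; move: u; apply: tmBe_ext => [u v|u v|X Y].
- rewrite (linear_morphD mulBe_linear).
  exact: (tsum_DeltaD L_coring FB).
- by rewrite (linear_morphD DeltaE_linear) (tsumD FmB).
- rewrite mulBe_tmBe (tsum_comulM _ _ FB) (tsum_DeltaE _ _ FmB).
  by apply: eq_tsum => *; apply: eq_tsum => *; rewrite !mulBe_tmBe.
Qed.

(** * The action of cochains on the tensor square *)

Local Notation translL := (@translate k B L B_X X_B D).

Section TensorSquare.
Variable U : C1 H.
Let UB : bimod_map H U := C1_bimod U.
Let UBL : bimap B_X X_B U := (bimod_mapP U).2 UB.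

(** Here the condition U (X s b) = U (X t b) turns the source on X1 into a
    target, which the Takeuchi condition moves back to a source on X2. *)
Lemma translL_s X b : translL U (X * s b) = translL U X * s b.
Proof.
have FB := la_balanced L_bimodule UBL; rewrite /translate (tsum_comulMs _ _ FB).
under eq_tsum do rewrite C1_st.
rewrite (tsum_comul_takeuchi _ _ FB) (tsum_lin _ _ (fun x y => mulrDl x y (s b))).
by apply: eq_tsum => *; rewrite mulrA.
Qed.

Lemma translL_t X b : translL U (X * t b) = translL U X * t b.
Proof.
have FB := la_balanced L_bimodule UBL; rewrite /translate (tsum_comulMt _ _ FB).
rewrite (tsum_lin _ _ (fun x y => mulrDl x y (t b))).
by apply: eq_tsum => *; rewrite mulrA.
Qed.

(** The B^e-balanced replacement for (X, Y) |-> U X * U Y, which does not make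
    sense over a noncommutative base. *)
Definition ext_square (u : E) : B := \tsum_(X, Y <- u) U (X * t (U Y)).

Lemma ext_square_bal : balancedBe (fun X Y => U (X * t (U Y))).
Proof.
split=> [X X' Y|X Y Y'|a X Y|a [b c] X Y] /=.
- by rewrite mulrDl (bmapD UB).
- by rewrite (bmapD UB) linearD mulrDr (bmapD UB).
- by rewrite (bmapZ UB) linearZ -scalerAl -scalerAr.
- rewrite (proj2 UB) !tgtM -!scalerAl !(bmapZ UB) mulrA.
  rewrite mulrA -[in RHS]C1_st; congr (_ *: U _).
  by rewrite -!mulrA; congr (_ * _); rewrite !mulrA src_tgtC -!mulrA src_tgtC.
Qed.

Lemma ext_square_tmBe X Y : ext_square (X (x)e Y) = U (X * t (U Y)).
Proof. exact: (tsum_tmk ext_square_bal). Qed.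

Lemma ext_square_linear : linear ext_square.
Proof.
apply: tsum_linear ext_square_bal _ => a X Y.
by rewrite -scalerAl (bmapZ UB).
Qed.

Lemma ext_square_bimap : bimap laE raE ext_square.
Proof.
have sD := linear_morphD ext_square_linear; split; first exact: ext_square_linear.
- move=> b; apply: tmBe_ext => [u v|u v|X Y]; rewrite ?laE_D ?sD ?mulrDr //.
  by rewrite laE_tmBe !ext_square_tmBe -mulrA (bmaps UB).
- move=> c; apply: tmBe_ext => [u v|u v|X Y]; rewrite ?raE_D ?sD ?mulrDl //.
  by rewrite raE_tmBe !ext_square_tmBe -mulrA (bmapt UB).
Qed.

(** By the Takeuchi condition the target t (U Y1) on X1 becomes s (U Y1) on the
    right of X2, and over B^e it then acts on the left of Y2. *)
Lemma translate_ext_square X Y :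
  translate DeltaE ext_square (X (x)e Y) = translL U X (x)e translL U Y.
Proof.
have sB := la_balanced E_bimodule ext_square_bimap.
rewrite /translate (tsum_DeltaE _ _ sB) pairsumC.
rewrite [RHS](tsum_lin _ _ (tmBeDr _)); apply: eq_tsum => Y1 Y2.
have tD : {morph (fun Z => Z (x)e Y2) : Z Z' / Z + Z'} by move=> *; exact: tmBeDl.
have FB := morph_balanced tD (la_balanced L_bimodule UBL).
under eq_tsum do rewrite laE_tmBe ext_square_tmBe.
rewrite (tsum_comul_takeuchi _ _ FB) -tmBe_s.
rewrite (tsum_lin _ _ (fun x y => mulrDl x y _)) [RHS](tsum_lin _ _ tD).
by apply: eq_tsum => X1 X2; rewrite mulrA.
Qed.

End TensorSquare.

Lemma triv2E u : triv2 u = eps (mulBe u).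
Proof. exact/esym/(tsum_lin _ _ (linearD (counit H))). Qed.

(** The unit of the convolution algebra of E is an external square as well, so
    that the left counit law of E is [translate_ext_square] for U = eps. *)
Lemma triv2_ext_square : @triv2 _ _ _ H = ext_square (C1_one H).
Proof.
apply/funext => u; apply: eq_tsum => X Y; exact/esym/counitMt.
Qed.

Lemma translL_counit X : translL (C1_one H) X = X.
Proof. exact: (translate_eps L_coring). Qed.

Lemma E_coring : coring DeltaE (@triv2 _ _ _ H).
Proof.
have oB : bimap laE raE (@triv2 _ _ _ H).
  by rewrite triv2_ext_square; exact: ext_square_bimap.
have lB := la_balanced E_bimodule oB; have rB := ra_balanced E_bimodule oB.
have DD := linear_morphD DeltaE_linear.
split=> //.
- exact: E_bimodule.
- exact: DeltaE_linear.
- exact: DeltaE_laE.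
- exact: DeltaE_raE.
- by move=> V F FB u; exact: DeltaE_coassoc.
- apply: tmBe_ext => [u v|u v|X Y] //; first by rewrite DD (tsumD lB).
  have := translate_ext_square (C1_one H) X Y.
  by rewrite !translL_counit -triv2_ext_square.
- apply: tmBe_ext => [u v|u v|X Y] //; first by rewrite DD (tsumD rB).
  rewrite (tsum_DeltaE _ _ rB) pairsumC.
  rewrite -[in RHS](counitr H Y) (tsum_lin _ _ (tmBeDr _)).
  apply: eq_tsum => Y1 Y2; rewrite -tmBe_t.
  rewrite -[in RHS](counitr H X) (tsum_lin _ _ (fun x y => mulrDl x y _)).
  have tD : {morph (fun Z => Z (x)e Y1) : Z Z' / Z + Z'}.
    by move=> *; exact: tmBeDl.
  rewrite [RHS](tsum_lin _ _ tD).
  have epsB : bimap B_X X_B eps by exact/bimod_mapP/eps_bimod.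
  have FB := morph_balanced tD (ra_balanced L_bimodule epsB).
  have := tsum_comul_takeuchi X (eps Y2) FB.
  under eq_tsum do rewrite mulrA.
  move=> ->; apply: eq_tsum => X1 X2; rewrite raE_tmBe triv2E mulBe_tmBe.
  by rewrite counitMs.
Qed.

Lemma tsum_tmBe (V : zmodType) (h : E -> V) u : {morph h : x y / x + y} ->
  \tsum_(X, Y <- u) h (X (x)e Y) = h u.
Proof. by move=> hD; rewrite -(tsum_lin _ _ hD) tsum_id. Qed.

Local Notation bimE := (bimap laE raE).

Lemma conv2E f g : bimE f -> bimE g -> conv2 f g =1 cor_conv DeltaE f g.
Proof.
move=> fB gB u; have FB := mul_balanced fB gB.
rewrite [RHS](tsum_lin _ _ (tsumD FB)); apply: eq_tsum => X Y.
by rewrite -DeltaE_tmBe (tsum_DeltaE _ _ FB).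
Qed.

Definition comp_mul (f : L -> B) (u : E) : B := f (mulBe u).

Lemma comp_mul_bimap f : bimap B_X X_B f -> bimE (comp_mul f).
Proof.
move=> [fl fs ft]; split=> [a u v|b u|c u]; rewrite /comp_mul.
- by rewrite mulBe_linear fl.
- by rewrite mulBe_laE fs.
- by rewrite mulBe_raE ft.
Qed.

(** Naturality of the action along the coring map from E to L. *)
Lemma mulBe_translate f u : bimap B_X X_B f ->
  mulBe (translate DeltaE (comp_mul f) u) = translL f (mulBe u).
Proof.
move=> fB; rewrite [RHS](tsum_comul_mulBe _ (la_balanced L_bimodule fB)).
rewrite (tsum_lin _ _ (linear_morphD mulBe_linear)).
by apply: eq_tsum => *; rewrite mulBe_laE.
Qed.

Lemma C1_bimap (U : C1 H) : bimap B_X X_B U.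
Proof. exact/bimod_mapP/C1_bimod. Qed.

Lemma translL_K (U V : C1 H) X :
  C1_mul U V = C1_one H -> translL V (translL U X) = X.
Proof.
move=> UV; rewrite -[RHS]translL_counit -UV.
by rewrite -(translate_conv L_coring) //; exact: C1_bimap.
Qed.

Lemma ext_square_conv (U V : C1 H) :
  cor_conv DeltaE (ext_square U) (ext_square V) =1 ext_square (C1_mul U V).
Proof.
have [sU sV] := (ext_square_bimap U, ext_square_bimap V).
have sUVD := linear_morphD (ext_square_linear (C1_mul U V)).
have cD := bimapD (cor_conv_bimap E_coring sU sV).
apply: tmBe_ext => // X Y.
rewrite -(bimap_translate _ _ _ sV) translate_ext_square !ext_square_tmBe.
rewrite !(bimap_translate _ _ _ (C1_bimap V)) -translL_t.
by rewrite (bimap_translate _ _ _ (C1_bimap V)).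
Qed.

Lemma comp_mul_conv f g : bimap B_X X_B f -> bimap B_X X_B g ->
  cor_conv DeltaE (comp_mul f) (comp_mul g) =1 comp_mul (conv H f g).
Proof.
move=> fB gB u; rewrite -(bimap_translate _ _ _ (comp_mul_bimap gB)) /comp_mul.
by rewrite mulBe_translate // bimap_translate.
Qed.

(** * The product attached to a 2-cochain *)

Section Product.
Variables (G : E -> B) (GB : bimE G).

Definition gprod (u : E) : L := mulBe (translate DeltaE G u).

Lemma gprod_linear : linear gprod.
Proof. by move=> a u v; rewrite /gprod (translate_linear E_coring GB) mulBe_linear. Qed.

(** The product determines G, which makes identities between products yield
    identities between 2-cochains. *)
Lemma eps_gprod u : eps (gprod u) = G u.
Proof. by rewrite -triv2E (eps_translate E_coring). Qed.

Let F v w := s (G v) * mulBe w.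

Lemma gprod_balanced : balE F.
Proof.
have := morph_balanced (linear_morphD mulBe_linear) (la_balanced E_bimodule GB).
congr balanced; apply/funext => v; apply/funext => w; exact: mulBe_laE.
Qed.

Lemma gprodE u : gprod u = \tsum_(v, w <- DeltaE u) F v w.
Proof.
rewrite /gprod (tsum_lin _ _ (linear_morphD mulBe_linear)).
by apply: eq_tsum => v w; rewrite mulBe_laE.
Qed.

Lemma gprod_pairsum X Y : gprod (X (x)e Y) = pairsum F X Y.
Proof. by rewrite gprodE (tsum_DeltaE _ _ gprod_balanced). Qed.

Lemma gprod_tmBe X Y : gprod (X (x)e Y) =
  \tsum_(X1, X2 <- D X) \tsum_(Y1, Y2 <- D Y) s (G (X1 (x)e Y1)) * X2 * Y2.
Proof.
rewrite gprod_pairsum; apply: eq_tsum => X1 X2; apply: eq_tsum => Y1 Y2.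
by rewrite /F mulBe_tmBe mulrA.
Qed.

(** The product is colinear on the right over the multiplication, since only
    the first legs enter G. *)
Lemma tsum_comul_gprod (V : zmodType) (K : L -> L -> V) u : balL K ->
  \tsum_(X1, X2 <- D (gprod u)) K X1 X2 =
  \tsum_(v, w <- DeltaE u) K (gprod v) (mulBe w).
Proof.
move=> KB; rewrite (tsum_comul_mulBe _ KB).
exact: (tsum_Delta_translate E_coring _ GB (balanced_mulBe KB)).
Qed.

Lemma gprod_comul_balanced (V : zmodType) (K : L -> L -> V) : balL K ->
  balE (fun v w => K (gprod v) (mulBe w)).
Proof.
have [mD mZ] := (linear_morphD mulBe_linear, linear_morphZ mulBe_linear).
have [gD gZ] := (linear_morphD gprod_linear, linear_morphZ gprod_linear).
move=> KB; split=> *; rewrite ?mD ?mZ ?gD ?gZ ?mulBe_laE.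
- exact: balDl KB _ _ _.
- exact: balDr KB _ _ _.
- exact: balZ KB _ _ _.
- by rewrite /gprod (translate_ra E_coring _ _ GB) mulBe_raE (balB KB).
Qed.

(** By colinearity both bracketings expand to the cocycle identity for
    (X1, Y1, Z1) times X2 Y2 Z2. *)
Lemma gprod_assoc :
  (forall X Y Z, G (X (x)e gprod (Y (x)e Z)) = G (gprod (X (x)e Y) (x)e Z)) ->
  forall X Y Z, gprod (X (x)e gprod (Y (x)e Z)) = gprod (gprod (X (x)e Y) (x)e Z).
Proof.
move=> GA X Y Z; rewrite [LHS]gprod_pairsum [RHS]gprod_pairsum pairsumC.
have FB := gprod_balanced.
have rB := balanced_tmBe_r FB X.
have lB : balL (fun W1 W2 => \tsum_(Z1, Z2 <- D Z) F (W1 (x)e Z1) (W2 (x)e Z2)).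
  by apply: tsum_balanced => *; exact: balanced_tmBe_l.
rewrite [LHS](tsum_comul_gprod _ rB) [LHS](tsum_DeltaE _ _ (gprod_comul_balanced rB)).
rewrite [RHS](tsum_comul_gprod _ lB) [RHS](tsum_DeltaE _ _ (gprod_comul_balanced lB)).
rewrite /pairsum.
transitivity (\tsum_(X1, X2 <- D X) \tsum_(Y1, Y2 <- D Y) \tsum_(Z1, Z2 <- D Z)
  F (X1 (x)e gprod (Y1 (x)e Z1)) (X2 (x)e mulBe (Y2 (x)e Z2))).
  rewrite [RHS]tsum_exchange; apply: eq_tsum => Y1 Y2.
  by rewrite [RHS]tsum_exchange.
apply: eq_tsum => X1 X2; apply: eq_tsum => Y1 Y2; apply: eq_tsum => Z1 Z2.
by rewrite /F GA !mulBe_tmBe !mulrA.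
Qed.

Lemma gprod_1l : (forall X, G (1 (x)e X) = eps X) -> forall X, gprod (1 (x)e X) = X.
Proof.
move=> G1 X; rewrite gprod_pairsum pairsumC -[RHS](counitl H).
apply: eq_tsum => X1 X2; rewrite (tsum_comul1 (balanced_tmBe_l gprod_balanced _ _)).
by rewrite /F G1 mulBe_tmBe mul1r.
Qed.

Lemma gprod_1r : (forall X, G (X (x)e 1) = eps X) -> forall X, gprod (X (x)e 1) = X.
Proof.
move=> G1 X; rewrite gprod_pairsum pairsumC.
rewrite (tsum_comul1 (balanced_tmBe_r gprod_balanced _)) -[RHS](counitl H).
by apply: eq_tsum => X1 X2; rewrite /F G1 mulBe_tmBe mulr1.
Qed.

Lemma gprod_t X Y b : gprod (X (x)e (Y * t b)) = gprod (X (x)e Y) * t b.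
Proof.
rewrite !gprod_pairsum !pairsumC (tsum_comulMt _ _ (balanced_tmBe_r gprod_balanced _)).
rewrite (tsum_lin _ _ (fun x y => mulrDl x y (t b))); apply: eq_tsum => Y1 Y2.
rewrite (tsum_lin _ _ (fun x y => mulrDl x y (t b))); apply: eq_tsum => X1 X2.
by rewrite /F !mulBe_tmBe !mulrA.
Qed.

Lemma gprod_s : (forall X Y b, G (X (x)e (Y * s b)) = G (X (x)e (Y * t b))) ->
  forall X Y b, gprod (X (x)e (Y * s b)) = gprod (X (x)e Y) * s b.
Proof.
move=> Gst X Y b; have rB := balanced_tmBe_r gprod_balanced X.
rewrite !gprod_pairsum !pairsumC (tsum_comulMs _ _ rB).
transitivity (\tsum_(Y1, Y2 <- D Y) \tsum_(X1, X2 <- D X)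
    F (X1 (x)e (Y1 * t b)) (X2 (x)e Y2)).
  by apply: eq_tsum => *; apply: eq_tsum => *; rewrite /F Gst.
rewrite (tsum_comul_takeuchi _ _ rB).
rewrite (tsum_lin _ _ (fun x y => mulrDl x y (s b))); apply: eq_tsum => Y1 Y2.
rewrite (tsum_lin _ _ (fun x y => mulrDl x y (s b))); apply: eq_tsum => X1 X2.
by rewrite /F !mulBe_tmBe !mulrA.
Qed.

End Product.

(** Conversely, applying the counit to associativity gives the cocycle
    identity. *)
Lemma Z2_gprod G : bimE G ->
  (forall X Y Z, gprod G (X (x)e gprod G (Y (x)e Z)) =
                 gprod G (gprod G (X (x)e Y) (x)e Z)) ->
  forall X Y Z,
    G (X (x)e \tsum_(Y1, Y2 <- D Y) \tsum_(Z1, Z2 <- D Z)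
                s (G (Y1 (x)e Z1)) * Y2 * Z2) =
    G ((\tsum_(X1, X2 <- D X) \tsum_(Y1, Y2 <- D Y)
                s (G (X1 (x)e Y1)) * X2 * Y2) (x)e Z).
Proof.
move=> GB GA X Y Z; rewrite -!gprod_tmBe // -[LHS]eps_gprod //.
by rewrite GA eps_gprod.
Qed.

Lemma Z2_bimap G : Z2 G -> bimE G.
Proof. by move=> GZ; apply/bimod_map2P/Z2_bimod. Qed.

Lemma Z2_assoc G : Z2 G -> forall X Y Z,
  gprod G (X (x)e gprod G (Y (x)e Z)) = gprod G (gprod G (X (x)e Y) (x)e Z).
Proof.
move=> GZ; have GB := Z2_bimap GZ; apply: gprod_assoc => // X Y Z.
by rewrite !gprod_tmBe // (Z2_cocycle GZ).
Qed.

(** * Twisting a 2-cocycle by a cochain *)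

Definition twist_conv (G : E -> B) (U : C1 H) : E -> B :=
  cor_conv DeltaE (ext_square (U^-1)%g) (cor_conv DeltaE G (comp_mul U)).

Lemma twist_conv_bimap G U : bimE G -> bimE (twist_conv G U).
Proof.
move=> GB; apply: (cor_conv_bimap E_coring); first exact: ext_square_bimap.
by apply: (cor_conv_bimap E_coring) => //; apply/comp_mul_bimap/C1_bimap.
Qed.

Lemma twist_conv_tmBe G U X Y : bimE G -> twist_conv G U (X (x)e Y) =
  \tsum_(X1, X' <- D X) \tsum_(X2, X3 <- D X')
  \tsum_(Y1, Y' <- D Y) \tsum_(Y2, Y3 <- D Y')
    C1_fun (U^-1)%g (X1 * t (C1_fun (U^-1)%g Y1)) * G (X2 (x)e Y2) * U (X3 * Y3).
Proof.
move=> GB; have pB := comp_mul_bimap (C1_bimap U).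
have GpB := mul_balanced GB pB.
have TB := mul_balanced (ext_square_bimap (U^-1)%g) (cor_conv_bimap E_coring GB pB).
rewrite [LHS](tsum_DeltaE _ _ TB); apply: eq_tsum => X1 X'.
rewrite [RHS]tsum_exchange; apply: eq_tsum => Y1 Y'.
rewrite ext_square_tmBe [cor_conv _ _ _ _](tsum_DeltaE _ _ GpB).
rewrite (tsum_lin _ _ (mulrDr _)); apply: eq_tsum => X2 X3.
rewrite (tsum_lin _ _ (mulrDr _)); apply: eq_tsum => Y2 Y3.
by rewrite /comp_mul mulBe_tmBe mulrA.
Qed.

Lemma twistE G U : bimE G -> twist G U = twist_conv G U.
Proof.
move=> GB; apply/funext => u.
rewrite -[RHS](tsum_tmBe _ (bimapD (twist_conv_bimap U GB))).
by apply: eq_tsum => X Y; rewrite twist_conv_tmBe.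
Qed.

Lemma triv2_bimap : bimE (@triv2 _ _ _ H).
Proof. exact: cor_eps E_coring. Qed.

Lemma twist_conv_triv2_tmBe (U : C1 H) X Y :
  twist_conv (@triv2 _ _ _ H) U (X (x)e Y) =
  \tsum_(X1, X2 <- D X) \tsum_(Y1, Y2 <- D Y)
    C1_fun U^-1%g (X1 * t (C1_fun U^-1%g Y1)) * U (X2 * Y2).
Proof.
have pB := comp_mul_bimap (C1_bimap U).
rewrite /twist_conv (funext (fun v => cor_conv_epsl E_coring v pB)).
rewrite [LHS](tsum_DeltaE _ _ (mul_balanced (ext_square_bimap _) pB)).
by apply: eq_tsum => *; apply: eq_tsum => *; rewrite ext_square_tmBe /comp_mul mulBe_tmBe.
Qed.

Lemma coboundaryE U : coboundary U = twist_conv (@triv2 _ _ _ H) U.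
Proof.
apply/funext => u; rewrite -[RHS](tsum_tmBe _ (bimapD (twist_conv_bimap U triv2_bimap))).
by apply: eq_tsum => X Y; rewrite twist_conv_triv2_tmBe.
Qed.

(** Transport of structure: twisting G by U conjugates its product by the
    action of U on L. *)
Lemma gprod_twist G U X Y : bimE G ->
  gprod (twist_conv G U) (X (x)e Y) =
  translL U (gprod G (translL (U^-1)%g X (x)e translL (U^-1)%g Y)).
Proof.
move=> GB; have pB := comp_mul_bimap (C1_bimap U).
have sB := ext_square_bimap (U^-1)%g.
rewrite /gprod (translate_conv E_coring) //; last exact: (cor_conv_bimap E_coring).
rewrite (translate_conv E_coring) // mulBe_translate ?translate_ext_square //.
exact: C1_bimap.
Qed.

Lemma gprod_triv2 u : gprod (@triv2 _ _ _ H) u = mulBe u.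
Proof. by rewrite /gprod (translate_eps E_coring). Qed.

Lemma translL_1 (U : C1 H) : translL U 1 = 1.
Proof.
rewrite /translate (tsum_comul1 (la_balanced L_bimodule (C1_bimap U))).
by rewrite C1_1 rmorph1 mulr1.
Qed.

(** The cocycle and normalization conditions are read off from the transported
    product, as the actions of U and U^-1 cancel and fix 1; invertibility comes
    from the factorization of the twist. *)
Lemma twist_Z2 G U : Z2 G -> Z2 (twist_conv G U).
Proof.
move=> GZ; have GB := Z2_bimap GZ; have tB := twist_conv_bimap U GB.
have pB W := comp_mul_bimap (C1_bimap W); have sB := ext_square_bimap.
have UK X : translL (U^-1)%g (translL U X) = X by apply/translL_K/C1_Vmul.
have VK X : translL U (translL (U^-1)%g X) = X by apply/translL_K/C1_mulV.
split.
- exact/bimod_map2P.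
- have [G' /bimod_map2P G'B [GG' G'G]] := Z2_invertible GZ.
  have sV : cor_conv DeltaE (ext_square (U^-1)%g) (ext_square U) =1 @triv2 _ _ _ H.
    by move=> u; rewrite ext_square_conv C1_mulV triv2_ext_square.
  have sU : cor_conv DeltaE (ext_square U) (ext_square (U^-1)%g) =1 @triv2 _ _ _ H.
    by move=> u; rewrite ext_square_conv C1_Vmul triv2_ext_square.
  have pU : cor_conv DeltaE (comp_mul U) (comp_mul (U^-1)%g) =1 @triv2 _ _ _ H.
    move=> u; rewrite comp_mul_conv ?triv2E; try exact: C1_bimap.
    exact: (C1_inv_inverse U).1.
  have pV : cor_conv DeltaE (comp_mul (U^-1)%g) (comp_mul U) =1 @triv2 _ _ _ H.
    move=> u; rewrite comp_mul_conv ?triv2E; try exact: C1_bimap.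
    exact: (C1_inv_inverse U).2.
  have GG'E : cor_conv DeltaE G G' =1 @triv2 _ _ _ H.
    by move=> u; rewrite -conv2E.
  have G'GE : cor_conv DeltaE G' G =1 @triv2 _ _ _ H.
    by move=> u; rewrite -conv2E.
  have GUB := cor_conv_bimap E_coring GB (pB U).
  have UGB := cor_conv_bimap E_coring (pB (U^-1)%g) G'B.
  have WB := cor_conv_bimap E_coring UGB (sB U).
  have GU := cor_conv_inverse E_coring GB G'B (pB U) (pB (U^-1)%g) GG'E pU.
  have UG := cor_conv_inverse E_coring (pB (U^-1)%g) (pB U) G'B GB pV G'GE.
  exists (cor_conv DeltaE (cor_conv DeltaE (comp_mul (U^-1)%g) G') (ext_square U)).
    exact/bimod_map2P.
  split=> u; rewrite conv2E //.
    exact: (cor_conv_inverse E_coring (sB _) (sB _) GUB UGB).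
  exact: (cor_conv_inverse E_coring UGB GUB (sB _) (sB _)).
- apply: Z2_gprod => // X Y Z.
  by rewrite !gprod_twist // !UK Z2_assoc.
- move=> X; rewrite -eps_gprod // gprod_twist // translL_1 gprod_1l ?VK //.
  exact: Z2_1l.
- move=> X; rewrite -eps_gprod // gprod_twist // translL_1 gprod_1r ?VK //.
  exact: Z2_1r.
- move=> X Y b; rewrite -!eps_gprod // !gprod_twist // translL_s translL_t.
  rewrite gprod_s ?gprod_t //; last exact: Z2_st.
  by rewrite translL_s translL_t eps_st.
Qed.

Lemma twist_conv_1 G : bimE G -> twist_conv G 1%g = G.
Proof.
move=> GB; apply/funext => u; rewrite /twist_conv invg1 -triv2_ext_square.
have e : comp_mul (1%g : C1 H) = @triv2 _ _ _ H by apply/funext => v; rewrite triv2E.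
rewrite e (cor_conv_epsl E_coring) ?(cor_conv_epsr E_coring) //.
by rewrite (funext (fun v => cor_conv_epsr E_coring v GB)).
Qed.

Lemma twist_conv_mul G (U V : C1 H) : bimE G ->
  twist_conv (twist_conv G U) V = twist_conv G (U * V)%g.
Proof.
move=> GB; apply/funext => u; rewrite /twist_conv invgM.
have pB W := comp_mul_bimap (C1_bimap W); have sB := ext_square_bimap.
have cB := cor_conv_bimap E_coring.
have A := cor_convA E_coring.
have e1 : ext_square (V^-1 * U^-1)%g =
          cor_conv DeltaE (ext_square V^-1%g) (ext_square U^-1%g).
  by apply/funext => v; rewrite ext_square_conv.
have e2 : comp_mul (U * V)%g = cor_conv DeltaE (comp_mul U) (comp_mul V).
  by apply/funext => v; rewrite comp_mul_conv //; exact: C1_bimap.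
have GUB := cB _ _ GB (pB U); have GUVB := cB _ _ GUB (pB V).
rewrite e1 e2 -(A _ _ _ _ (sB _) (sB _)); last first.
  by apply: (cB) => //; apply: (cB).
congr (cor_conv _ _ _ u); apply/funext => v.
rewrite -(A _ _ _ _ (sB _) GUB (pB V)); congr (cor_conv _ _ _ v).
by apply/funext => w; rewrite (A _ _ _ _ GB (pB U) (pB V)).
Qed.

Lemma triv2_Z2 : Z2 (@triv2 _ _ _ H).
Proof.
have tB := triv2_bimap; split.
- exact/bimod_map2P.
- exists (@triv2 _ _ _ H); first exact/bimod_map2P.
  by split=> u; rewrite conv2E // (cor_conv_epsl E_coring).
- by apply: Z2_gprod => // X Y Z; rewrite !gprod_triv2 !mulBe_tmBe mulrA.
- by move=> X; rewrite triv2E mulBe_tmBe mul1r.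
- by move=> X; rewrite triv2E mulBe_tmBe mulr1.
- by move=> X Y b; rewrite !triv2E !mulBe_tmBe !mulrA eps_st.
Qed.

(** * One-cocycles and vertical bisections *)

Lemma Z1P (U : C1 H) :
  reflect (coboundary U = @triv2 _ _ _ H) (U \in Z1 H).
Proof.
rewrite inE; apply: (iffP (asboolP _)) => [e|-> X Y]; last first.
  by rewrite triv2E mulBe_tmBe.
apply/funext; apply: tmBe_ext => [||X Y].
- by rewrite coboundaryE; exact: bimapD (twist_conv_bimap _ triv2_bimap).
- exact: bimapD triv2_bimap.
- by rewrite e triv2E mulBe_tmBe.
Qed.

(** Writing X and Y as values of the action of U, triviality of the coboundary
    reads U (X Y) = eps (phi_U X phi_U Y); the counit axiom then allows phi_U Y
    to be replaced by s (eps (phi_U Y)) = s (U Y), which moves inside phi_U. *)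
Lemma Z1_multiplicative (U : C1 H) :
  U \in Z1 H <-> forall X Y, U (X * Y) = U (X * s (U Y)).
Proof.
have UB := C1_bimap U.
have UK X : translL (U^-1)%g (translL U X) = X by apply/translL_K/C1_Vmul.
have VK X : translL U (translL (U^-1)%g X) = X by apply/translL_K/C1_mulV.
have epsU X : eps (translL U X) = U X by exact: (eps_translate L_coring).
have cobE X Y : coboundary U (X (x)e Y) =
    U (translL (U^-1)%g X * translL (U^-1)%g Y).
  rewrite coboundaryE -eps_gprod; last exact: twist_conv_bimap triv2_bimap.
  by rewrite gprod_twist ?gprod_triv2 ?mulBe_tmBe ?epsU //; exact: triv2_bimap.
have epsM X Y : eps (translL U X * translL U Y) = U (X * s (U Y)).
  by rewrite -counitMs epsU -translL_s epsU.
split=> [/Z1P e X Y|e].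
  by rewrite -epsM -[X in LHS]UK -[Y in LHS]UK -cobE e triv2E mulBe_tmBe.
apply/asboolP => X Y.
by rewrite cobE e -epsM !VK.
Qed.

(** A vertical bisection carries no left linearity over s, but it follows from
    multiplicativity: sg (s b X) = sg (s b s (sg X)) = sg (s (b sg X)). *)
Lemma Z1_vertical_bisection (sg : L -> B) :
  (exists2 U : C1 H, U \in Z1 H & C1_fun U = sg) <->
  vertical_bisection H sg /\ conv_invertible H sg.
Proof.
split=> [[U /Z1_multiplicative UM <-]|[sV sI]].
  have UB := C1_bimod U; split; last exact: C1_invertible.
  split=> [||b X|b|X Y|X Y]; first by case: UB.
  - exact: C1_1.
  - exact: bmapt.
  - by rewrite -[s b]mulr1 (bmaps UB) C1_1 mulr1.
  - by rewrite UM C1_st.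
  - exact: UM.
have [sl s1 sgt sgs sMt sMs] := sV.
have sB : bimod_map H sg.
  apply/bimod_mapP; split=> // b X.
  by rewrite sMs -rmorphM sgs.
have sst X b : sg (X * s b) = sg (X * t b) by rewrite sMt sgs.
exists (MkC1 sB sI s1 sst) => //.
by apply/Z1_multiplicative.
Qed.

(** The 1-cocycles are the stabilizer of the trivial 2-cocycle under the
    twisting action. *)
Lemma Z1_monoid_closed : monoid_closed (Z1 H).
Proof.
split=> [|U V /Z1P eU /Z1P eV]; apply/Z1P; rewrite coboundaryE.
  by rewrite twist_conv_1 //; exact: triv2_bimap.
rewrite -twist_conv_mul; last exact: triv2_bimap.
by rewrite -coboundaryE eU -coboundaryE.
Qed.

End Bialgebroid.

(** * Cocycles, coboundaries and the twisting action *)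

Theorem theorem3p8 (k : fieldType) (B L : algType k)
    (H : left_bialgebroid B L) :
  [/\ (* (1), the coboundary of a cochain is a cocycle *)
      forall U : C1 H,
        (forall X Y : L, coboundary U (tmBe H X Y) =
           \tsum_(X1, X2 <- comul H X) \tsum_(Y1, Y2 <- comul H Y)
             C1_fun U^-1%g (X1 * tgt H (C1_fun U^-1%g Y1)) * U (X2 * Y2)) /\
        Z2 (coboundary U),
      (* (1), the submonoid Z1 *)
      [/\ monoid_closed (Z1 H),
          forall sg : L -> B,
            (exists2 U : C1 H, U \in Z1 H & C1_fun U = sg) <->
            vertical_bisection H sg /\ conv_invertible H sg,
          C1_fun (1%g : C1 H) = counit H &
          {in Z1 H &, forall U V : C1 H,
            C1_fun (U * V)%g = vb_mul H V U}] &
      (* (2) *)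
      [/\ forall (G : tensBe H -> B) (U : C1 H), Z2 G ->
            (forall X Y : L, twist G U (tmBe H X Y) =
               \tsum_(X1, X' <- comul H X) \tsum_(X2, X3 <- comul H X')
               \tsum_(Y1, Y' <- comul H Y) \tsum_(Y2, Y3 <- comul H Y')
                 C1_fun U^-1%g (X1 * tgt H (C1_fun U^-1%g Y1))
                   * G (tmBe H X2 Y2) * U (X3 * Y3)) /\
            Z2 (twist G U),
          forall G : tensBe H -> B, Z2 G -> twist G (1%g : C1 H) = G &
          forall (G : tensBe H -> B) (U V : C1 H), Z2 G ->
            twist (twist G U) V = twist G (U * V)%g]].
Proof.
split.
- move=> U; rewrite coboundaryE.
  split=> [X Y|]; first exact: twist_conv_triv2_tmBe.
  exact/twist_Z2/triv2_Z2.
- split=> //; first exact: Z1_monoid_closed; first exact: Z1_vertical_bisection.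
  move=> U V _ _; apply/funext => X; apply: eq_tsum => X1 X2.
  by rewrite (bmaps (C1_bimod V)).
- split=> [G U GZ|G GZ|G U V GZ]; have GB := Z2_bimap GZ.
  + rewrite twistE //; split=> [X Y|]; [exact: twist_conv_tmBe | exact: twist_Z2].
  + by rewrite twistE // twist_conv_1.
  + by rewrite !twistE ?twist_conv_mul //; exact: twist_conv_bimap.
Qed.
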